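(* Let $\mathcal{T}$ be a Krull-Schmidt triangulated category such that for any silting subcategory $\mathcal{M}$ of $\mathcal{T}$ and any indecomposable object $X\in\mathcal{M}$, the subcategory $\mathcal{M}_X$ is functorially finite in $\mathcal{M}$. For any silting subcategories $\mathcal{M},\mathcal{N}$ of $\mathcal{T}$, the following conditions are equivalent. (a) $\mathcal{N}$ is an irreducible left mutation of $\mathcal{M}$. (b) $\mathcal{M}$ is an irreducible right mutation of $\mathcal{N}$. (c) $\mathcal{M}>\mathcal{N}$ and there is no silting subcategory $\mathcal{L}$ of $\mathcal{T}$ satisfying $\mathcal{M}>\mathcal{L}>\mathcal{N}$.
   Context: A ''subcategory'' always means a full subcategory closed under isomorphisms, finite coproducts and direct summands; $\mathrm{add}\,\mathcal{X}$ is the smallest such subcategory containing $\mathcal{X}$. $\mathcal{T}$ is Krull-Schmidt if any object is a finite coproduct of objects with local endomorphism rings. $\mathrm{ind}\,\mathcal{M}$ is the set of isomorphism classes of indecomposable objects in $\mathcal{M}$. A subcategory $\mathcal{M}$ of $\mathcal{T}$ is silting if $\mathrm{Hom}_{\mathcal{T}}(M,M'[i])=0$ for all $M,M'\in\mathcal{M}$, $i>0$, and the smallest thick subcategory containing $\mathcal{M}$ is $\mathcal{T}$. For silting $\mathcal{M},\mathcal{N}$, write $\mathcal{M}\ge\mathcal{N}$ if $\mathrm{Hom}_{\mathcal{T}}(M,N[i])=0$ for all $M\in\mathcal{M}$, $N\in\mathcal{N}$, $i>0$ (this is a partial order); $\mathcal{M}>\mathcal{N}$ means $\mathcal{M}\ge\mathcal{N}$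 and $\mathcal{M}\ne\mathcal{N}$. A left $\mathcal{D}$-approximation of $M$ is a morphism $f:M\to D$ with $D\in\mathcal{D}$ such that $\mathrm{Hom}_{\mathcal{T}}(f,D')$ is surjective for all $D'\in\mathcal{D}$; $\mathcal{D}$ is covariantly finite in $\mathcal{M}$ if every object of $\mathcal{M}$ has one. Right approximations and contravariant finiteness are dual; functorially finite means both. For $\mathcal{D}$ covariantly finite in $\mathcal{M}$, take for each $M\in\mathcal{M}$ a triangle $M\xrightarrow{f}D\to N_M\to M[1]$ with $f$ a left $\mathcal{D}$-approximation and put $\mu^+(\mathcal{M};\mathcal{D}):=\mathrm{add}(\mathcal{D}\cup\{N_M\mid M\in\mathcal{M}\})$ (left mutation). Dually, for $\mathcal{D}$ contravariantly finite, using triangles $N_M\to D\xrightarrow{g}M\to N_M[1]$ with $g$ a right $\mathcal{D}$-approximation, put $\mu^-(\mathcal{M};\mathcal{D}):=\mathrm{add}(\mathcal{D}\cup\{N_M\mid M\in\mathcal{M}\})$ (right mutation). These do not depend on choices. For $X\in\mathcal{M}$ indecomposable, $\mathcal{M}_X$ is the subcategory of $\mathcal{M}$ with $\mathrm{ind}\,\mathcal{M}_X=\mathrm{ind}\,\mathcal{M}\setminus\{X\}$. An irreducible left (respectively, right) mutation of $\mathcal{M}$ is $\mu^{+}_X(\mathcal{M}):=\mu^{+}(\mathcal{M};\mathcal{M}_X)$ (respectively, $\mu^{-}_X(\mathcal{M}):=\mu^{-}(\mathcal{M};\mathcal{M}_X)$) for some indecomposable $X\in\mathcal{M}$. *)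

(* Defs.v *)
From mathcomp Require Import all_boot all_algebra.
From mathcomp Require Import classical_sets.

Set Implicit Arguments.
Unset Strict Implicit.
Unset Printing Implicit Defensive.

Import GRing.Theory.

Local Open Scope classical_set_scope.
Local Open Scope ring_scope.

Declare Scope cat_scope.
Delimit Scope cat_scope with cat.
Local Open Scope cat_scope.

(* Hom groups are zmodTypes; the choice structure this carries is no
   restriction, since every type has one in classical logic. *)
Record preadditive := Preadditive {
  obj :> Type;
  Hom : obj -> obj -> zmodType;
  idm : forall X, Hom X X;
  comp : forall X Y Z, Hom Y Z -> Hom X Y -> Hom X Z;
  compA : forall W X Y Z (h : Hom Y Z) (g : Hom X Y) (f : Hom W X),
    comp h (comp g f) = comp (comp h g) f;
  comp1m : forall X Y (f : Hom X Y), comp (idm Y) f = f;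
  compm1 : forall X Y (f : Hom X Y), comp f (idm X) = f;
  compDl : forall X Y Z (g g' : Hom Y Z) (f : Hom X Y),
    comp (g + g') f = comp g f + comp g' f;
  compDr : forall X Y Z (g : Hom Y Z) (f f' : Hom X Y),
    comp g (f + f') = comp g f + comp g f'
}.

Arguments Hom {p} X Y.
Arguments idm {p} X.
Arguments comp {p X Y Z} g f.

Notation "g \o f" := (comp g f) : cat_scope.

Definition is_iso (C : preadditive) (X Y : C) (f : Hom X Y) : Prop :=
  exists g : Hom Y X, g \o f = idm X /\ f \o g = idm Y.

Definition isomorphic (C : preadditive) (X Y : C) : Prop :=
  exists f : Hom X Y, is_iso f.

(* Initial and terminal: all morphisms from and to X are zero. *)
Definition is_zero (C : preadditive) (X : C) : Prop :=
  forall Y : C, (forall f : Hom X Y, f = 0) /\ (forall f : Hom Y X, f = 0).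

Definition is_coproduct (C : preadditive) (I : finType) (X : I -> C) (S : C) :
    Prop :=
  exists iota : forall i, Hom (X i) S,
    forall (Z : C) (f : forall i, Hom (X i) Z),
      exists! h : Hom S Z, forall i, h \o iota i = f i.

Definition is_coproduct2 (C : preadditive) (X Y S : C) : Prop :=
  is_coproduct (fun b : bool => if b then X else Y) S.

Record triangulated := Triangulated {
  underlying :> preadditive;
  coproducts : forall (I : finType) (X : I -> underlying),
    exists S, is_coproduct X S;
  (* the suspension [1], an additive autoequivalence *)
  shift : underlying -> underlying;
  shiftm : forall X Y : underlying,
    {additive Hom X Y -> Hom (shift X) (shift Y)};
  shiftm1 : forall X, shiftm X X (idm X) = idm (shift X);
  shiftm_comp : forall X Y Z (g : Hom Y Z) (f : Hom X Y),
    shiftm X Z (g \o f) = shiftm Y Z g \o shiftm X Y f;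
  shiftm_bij : forall X Y, bijective (shiftm X Y);
  shift_esurj : forall X, exists Y, isomorphic (shift Y) X;
  (* distinguished triangles X -> Y -> Z -> X[1] *)
  triangle : forall X Y Z : underlying,
    Hom X Y -> Hom Y Z -> Hom Z (shift X) -> Prop;
  triangle_iso : forall X Y Z X' Y' Z'
      (u : Hom X Y) (v : Hom Y Z) (w : Hom Z (shift X))
      (u' : Hom X' Y') (v' : Hom Y' Z') (w' : Hom Z' (shift X'))
      (a : Hom X X') (b : Hom Y Y') (c : Hom Z Z'),
    is_iso a -> is_iso b -> is_iso c ->
    b \o u = u' \o a -> c \o v = v' \o b -> shiftm X X' a \o w = w' \o c ->
    triangle u v w -> triangle u' v' w';
  tr1_id : forall X Z : underlying, is_zero Z ->
    triangle (idm X) (0 : Hom X Z) (0 : Hom Z (shift X));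
  tr1_cone : forall X Y (u : Hom X Y),
    exists Z (v : Hom Y Z) (w : Hom Z (shift X)), triangle u v w;
  tr2 : forall X Y Z (u : Hom X Y) (v : Hom Y Z) (w : Hom Z (shift X)),
    triangle u v w <-> triangle v w (- shiftm X Y u);
  tr3 : forall X Y Z X' Y' Z'
      (u : Hom X Y) (v : Hom Y Z) (w : Hom Z (shift X))
      (u' : Hom X' Y') (v' : Hom Y' Z') (w' : Hom Z' (shift X'))
      (a : Hom X X') (b : Hom Y Y'),
    triangle u v w -> triangle u' v' w' -> b \o u = u' \o a ->
    exists c : Hom Z Z', c \o v = v' \o b /\ shiftm X X' a \o w = w' \o c;
  tr4 : forall X Y Z Z' X' Y' (u : Hom X Y) (v : Hom Y Z)
      (j : Hom Y Z') (k : Hom Z' (shift X))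
      (l : Hom Z X') (i : Hom X' (shift Y))
      (m : Hom Z Y') (n : Hom Y' (shift X)),
    triangle u j k -> triangle v l i -> triangle (v \o u) m n ->
    exists (f : Hom Z' Y') (g : Hom Y' X'),
      triangle f g (shiftm Y Z' j \o i) /\
      [/\ f \o j = m \o v, n \o f = k, g \o m = l
        & i \o g = shiftm X Y u \o n]
}.

Arguments shift {t} X.
Arguments shiftm {t X Y}.
Arguments triangle {t X Y Z} u v w.

Section KrullSchmidt.
Variable C : preadditive.

(* The ring End(X) is local: it is nonzero and its non-units are closed under
   addition. *)
Definition local_end (X : C) : Prop :=
  idm X <> 0 /\
  forall f g : Hom X X, ~ is_iso f -> ~ is_iso g -> ~ is_iso (f + g).

Definition krull_schmidt : Prop :=
  forall X : C, exists (I : finType) (Y : I -> C),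
    (forall i, local_end (Y i)) /\ is_coproduct Y X.

Definition indecomposable (X : C) : Prop :=
  ~ is_zero X /\
  forall Y Z : C, is_coproduct2 Y Z X -> is_zero Y \/ is_zero Z.

(* Full subcategories closed under isomorphisms are identified with sets of
   objects. *)
Definition is_subcategory (D : set C) : Prop :=
  [/\ forall X Y : C, isomorphic X Y -> D X -> D Y,
      forall (I : finType) (X : I -> C) (S : C),
        is_coproduct X S -> (forall i, D (X i)) -> D S
    & forall X Y S : C, is_coproduct2 X Y S -> D S -> D X].

Definition add (G : set C) : set C := smallest is_subcategory G.

(* The indecomposable objects of M: the union of the classes in ind M. *)
Definition ind (M : set C) : set C := M `&` indecomposable.

(* D is the subcategory M_X of M. *)
Definition is_remove (M : set C) (X : C) (D : set C) : Prop :=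
  [/\ is_subcategory D, D `<=` M & ind D = ind M `\` isomorphic X].

Definition left_approx (D : set C) (M Y : C) (f : Hom M Y) : Prop :=
  D Y /\ forall (Y' : C) (g : Hom M Y'), D Y' -> exists h : Hom Y Y', h \o f = g.

Definition right_approx (D : set C) (M Y : C) (f : Hom Y M) : Prop :=
  D Y /\ forall (Y' : C) (g : Hom Y' M), D Y' -> exists h : Hom Y' Y, f \o h = g.

Definition covariantly_finite (D M : set C) : Prop :=
  forall X, M X -> exists (Y : C) (f : Hom X Y), left_approx D f.

Definition contravariantly_finite (D M : set C) : Prop :=
  forall X, M X -> exists (Y : C) (f : Hom Y X), right_approx D f.

Definition functorially_finite (D M : set C) : Prop :=
  covariantly_finite D M /\ contravariantly_finite D M.

End KrullSchmidt.

Section Silting.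
Variable T : triangulated.

(* Since [1] is essentially surjective and P is closed under isomorphisms,
   the second clause is closure under both [1] and [-1]. *)
Definition is_thick (P : set T) : Prop :=
  [/\ is_subcategory P,
      forall X : T, P (shift X) <-> P X
    & forall (X Y Z : T) (u : Hom X Y) (v : Hom Y Z) (w : Hom Z (shift X)),
        triangle u v w -> P X -> P Y -> P Z].

(* Hom(X, Y[i]) = 0 for all X in M, Y in N and i > 0; on silting
   subcategories this is the order M >= N. *)
Definition silting_ge (M N : set T) : Prop :=
  forall (X Y : T) (i : nat), M X -> N Y -> (0 < i)%N ->
    forall f : Hom X (iter i shift Y), f = 0.

Definition silting_gt (M N : set T) : Prop := silting_ge M N /\ M <> N.

Definition silting (M : set T) : Prop :=
  [/\ is_subcategory M, silting_ge M M & smallest is_thick M = setT].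

(* N is mu^+(M; D), computed from some choice of triangles
   X -> Y -> cone X -> X[1], one for each X in M. *)
Definition is_left_mutation (M D N : set T) : Prop :=
  exists cone : T -> T,
    (forall X, M X ->
      exists (Y : T) (f : Hom X Y) (g : Hom Y (cone X))
             (h : Hom (cone X) (shift X)),
        left_approx D f /\ triangle f g h) /\
    N = add (D `|` cone @` M).

(* N is mu^-(M; D), computed from some choice of triangles
   cocone X -> Y -> X -> (cocone X)[1], one for each X in M. *)
Definition is_right_mutation (M D N : set T) : Prop :=
  exists cocone : T -> T,
    (forall X, M X ->
      exists (Y : T) (f : Hom (cocone X) Y) (g : Hom Y X)
             (h : Hom X (shift (cocone X))),
        right_approx D g /\ triangle f g h) /\
    N = add (D `|` cocone @` M).

Definition irreducible_left_mutation (M N : set T) : Prop :=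
  exists (X : T) (D : set T),
    [/\ M X, indecomposable X, is_remove M X D & is_left_mutation M D N].

Definition irreducible_right_mutation (M N : set T) : Prop :=
  exists (X : T) (D : set T),
    [/\ M X, indecomposable X, is_remove M X D & is_right_mutation M D N].

End Silting.

(* Main.v *)
Require Import Defs.
From mathcomp Require Import all_boot all_algebra.
From mathcomp Require Import boolp classical_sets.
Import Defs.

Set Implicit Arguments.
Unset Strict Implicit.
Unset Printing Implicit Defensive.

Import GRing.Theory.

Local Open Scope classical_set_scope.
Local Open Scope ring_scope.
Local Open Scope cat_scope.

(** Both mutation conditions are compared with the covering condition (M > N
    with no silting subcategory strictly between), which is self-dual: passing
    to the opposite category reverses the order on silting subcategories and
    exchanges left and right mutations.  So it is enough to compare irreducible
    left mutations with covers, for a class of categories closed under taking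
    opposites.
    Such a class is that of the structures [wtri]: additive
    categories with mutually quasi-inverse operations [1] and [-1]
    on objects, and a set of pairs X -> Y -> Z, the triangles whose third
    morphism has been forgotten, subject to a self-dual list of consequences
    of the axioms of triangulated categories.

    The silting theory rests on one fact ([weight]).  By thick generation,
    every object Z is a retract of an iterated extension of shifts of objects
    of M; as Hom(M, M[>0]) = 0, the shifts can be sorted, so that Z is a
    retract of some V with triangles A -> V -> B and A' -> A -> M0, where A'
    is built from M[<0], M0 lies in M and B is built from M[>0].  Hence: if
    Hom(Z, M[>0]) = 0 then Z has a left M-approximation, if Hom(M, Z[>0]) = 0
    then it has a right one, if both hold then Z is in M ([silting_maximal]),
    and Hom(X, M[>0]) = 0 = Hom(M, Y[>0]) implies Hom(X, Y[>0]) = 0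
    ([silting_orthogonal]).  The last two make the relation >= transitive and
    antisymmetric.

    The core of this comparison is [mutation_between]: if M > N are silting then
    some irreducible left mutation L of M satisfies L >= N.  Take Z in N but
    not in M and the largest l with Hom(Z, M[l]) <> 0; it is positive.  Let
    X[l] be a summand of the target of a left approximation of Z in M[l]
    with as few indecomposable summands as possible.  If a morphism X -> V
    with V in N did not factor through M_X, then X would occur in a right
    M-approximation M0 -> V, again with as few summands as possible.  But
    Hom(Z, V[l]) = 0, so Z -> X[l] -> M0[l] lifts to the cocone of
    M0[l] -> V[l], and from there, by [silting_orthogonal], to an object of
    M[l]; the minimality of both approximations forbids this.  So every
    morphism from M to N factors through a left M_X-approximation, which
    gives Hom(L, N[1]) = 0.

    Given this, a cover M > N is a mutation since M > L >= N forces L = N.  Conversely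
    let N be the mutation of M at X and suppose M > L > N.  Some mutation M'
    of M at X' satisfies M' >= L >= N.  If X' is X then N >= M' >= L, so
    L = N.  Otherwise X' lies in M and in N, and M >= M' >= N puts it in M',
    whereas a mutation at X' never contains X'. *)

(** * Preadditive categories: biproducts and retracts *)

Section Preadditive.
Variable C : preadditive.
Implicit Types (X Y Z W : C) (D M : set C).

Lemma comp0m X Y Z (f : Hom X Y) : (0 : Hom Y Z) \o f = 0.
Proof. by apply: (addIr (0 \o f)); rewrite -compDl !add0r. Qed.

Lemma compm0 X Y Z (f : Hom Y Z) : f \o (0 : Hom X Y) = 0.
Proof. by apply: (addIr (f \o 0)); rewrite -compDr !add0r. Qed.

Lemma compNm X Y Z (g : Hom Y Z) (f : Hom X Y) : (- g) \o f = - (g \o f).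
Proof. by apply: (addIr (g \o f)); rewrite -compDl !addNr comp0m. Qed.

Lemma compmN X Y Z (g : Hom Y Z) (f : Hom X Y) : g \o (- f) = - (g \o f).
Proof. by apply: (addIr (g \o f)); rewrite -compDr !addNr compm0. Qed.

Lemma compBl X Y Z (g g' : Hom Y Z) (f : Hom X Y) :
  (g - g') \o f = (g \o f) - (g' \o f).
Proof. by rewrite compDl compNm. Qed.

Lemma compBr X Y Z (g : Hom Y Z) (f f' : Hom X Y) :
  g \o (f - f') = (g \o f) - (g \o f').
Proof. by rewrite compDr compmN. Qed.

Lemma comp_suml X Y Z (I : Type) (r : seq I) (P : pred I)
    (g : I -> Hom Y Z) (f : Hom X Y) :
  (\sum_(i <- r | P i) g i) \o f = \sum_(i <- r | P i) (g i \o f).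
Proof.
by apply: (big_morph (fun g => g \o f)) => [? ?|]; rewrite ?compDl ?comp0m.
Qed.

Lemma comp_sumr X Y Z (I : Type) (r : seq I) (P : pred I)
    (g : Hom Y Z) (f : I -> Hom X Y) :
  g \o (\sum_(i <- r | P i) f i) = \sum_(i <- r | P i) (g \o f i).
Proof.
by apply: (big_morph (fun f => g \o f)) => [? ?|]; rewrite ?compDr ?compm0.
Qed.

Lemma is_zeroP X : is_zero X <-> idm X = 0.
Proof.
split=> [X0|X0 Y]; first by case: (X0 X).
by split=> f; [rewrite -[f]compm1|rewrite -[f]comp1m];
  rewrite X0 ?compm0 ?comp0m.
Qed.

Lemma is_iso_id X : is_iso (idm X).
Proof. by exists (idm X); rewrite comp1m. Qed.

Lemma is_iso_comp X Y Z (g : Hom Y Z) (f : Hom X Y) :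
  is_iso g -> is_iso f -> is_iso (g \o f).
Proof.
move=> [g' [g'g gg']] [f' [f'f ff']]; exists (f' \o g'); split.
  by rewrite compA -(compA f') g'g compm1.
by rewrite compA -(compA g) ff' compm1.
Qed.

Lemma is_isoN X Y (f : Hom X Y) : is_iso f -> is_iso (- f).
Proof.
by move=> [g [gf fg]]; exists (- g); rewrite !compmN !compNm !opprK.
Qed.

Lemma isomorphic_refl X : isomorphic X X.
Proof. by exists (idm X); apply: is_iso_id. Qed.

Lemma isomorphic_sym X Y : isomorphic X Y -> isomorphic Y X.
Proof. by move=> [f [g [gf fg]]]; exists g, f. Qed.

Lemma isomorphic_trans X Y Z :
  isomorphic X Y -> isomorphic Y Z -> isomorphic X Z.
Proof. by move=> [f fi] [g gi]; exists (g \o f); apply: is_iso_comp. Qed.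

(** X is a retract of Y; no complement of X in Y is required. *)
Definition retract X Y : Prop :=
  exists (a : Hom X Y) (b : Hom Y X), b \o a = idm X.

Lemma isomorphic_retract X Y : isomorphic X Y -> retract X Y.
Proof. by move=> [f [g [gf fg]]]; exists f, g. Qed.

Lemma retract_trans X Y Z : retract X Y -> retract Y Z -> retract X Z.
Proof.
move=> [a [b ba]] [c [d dc]]; exists (c \o a), (b \o d).
by rewrite compA -(compA b) dc compm1.
Qed.

(** The self-dual description of a finite coproduct. *)
Definition biproduct (I : finType) (X : I -> C) S
    (iota : forall i, Hom (X i) S) (pi : forall i, Hom S (X i)) : Prop :=
  [/\ forall i, pi i \o iota i = idm (X i),
      forall i j, i != j -> pi j \o iota i = 0
    & \sum_i (iota i \o pi i) = idm S].

Lemma coproductP (I : finType) (X : I -> C) S :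
  is_coproduct X S <-> exists iota pi, @biproduct I X S iota pi.
Proof.
split=> [[iota univ]|[iota [pi [pii pi0 sum1]]]].
  pose delta i j : Hom (X i) (X j) :=
    match i =P j with
    | ReflectT e => ecast k (Hom (X i) (X k)) e (idm (X i))
    | ReflectF _ => 0
    end.
  have delta1 i : delta i i = idm (X i).
    by rewrite /delta; case: eqP => // e; rewrite (eq_axiomK e).
  have delta0 i j : i != j -> delta i j = 0.
    by rewrite /delta; case: eqP.
  have [pi piP] : exists pi : forall j, Hom S (X j),
      forall j i, pi j \o iota i = delta i j.
    exists (fun j => projT1 (cid (univ _ (fun i => delta i j)))) => j i.
    by case: cid => /= h [].
  exists iota, pi; split=> [i|i j ij|].
  - by rewrite piP delta1.
  - by rewrite piP delta0.
  have [h [_ uniq_h]] := univ _ iota.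
  rewrite -(uniq_h (idm S)) => [|i]; last by rewrite comp1m.
  apply/esym/uniq_h => i; rewrite comp_suml (bigD1 i) //= -compA piP delta1.
  rewrite compm1 big1 ?addr0 // => j ji.
  by rewrite -compA piP delta0 ?compm0 // eq_sym.
exists iota => Z f; exists (\sum_i (f i \o pi i)); split=> [i|h hf].
  rewrite comp_suml (bigD1 i) //= -compA pii compm1 big1 ?addr0 // => j ji.
  by rewrite -compA pi0 ?compm0 // eq_sym.
rewrite -[h]compm1 -sum1 comp_sumr; apply: eq_bigr => i _.
by rewrite compA hf.
Qed.

Lemma coproduct2P X Y S :
  is_coproduct2 X Y S <->
  exists (i1 : Hom X S) (i2 : Hom Y S) (p1 : Hom S X) (p2 : Hom S Y),
    [/\ p1 \o i1 = idm X, p2 \o i2 = idm Y, p2 \o i1 = 0, p1 \o i2 = 0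
      & (i1 \o p1) + (i2 \o p2) = idm S].
Proof.
rewrite /is_coproduct2 coproductP; split.
  move=> [iota [pi [pii pi0 sum1]]].
  exists (iota true), (iota false), (pi true), (pi false); split.
  - exact: (pii true).
  - exact: (pii false).
  - exact: (pi0 true false).
  - exact: (pi0 false true).
  - by rewrite -sum1 big_bool.
move=> [i1 [i2 [p1 [p2 [e1 e2 e3 e4 e5]]]]].
exists (fun b : bool => if b return Hom (if b then X else Y) S then i1 else i2).
exists (fun b : bool => if b return Hom S (if b then X else Y) then p1 else p2).
by split=> [[]|[] []|] //; rewrite big_bool.
Qed.

Lemma coproduct2_retractl X Y S : is_coproduct2 X Y S -> retract X S.
Proof.
by move=> /coproduct2P [i1 [i2 [p1 [p2 [e1 _ _ _ _]]]]]; exists i1, p1.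
Qed.

Lemma coproduct2_sym X Y S : is_coproduct2 X Y S -> is_coproduct2 Y X S.
Proof.
move=> /coproduct2P [i1 [i2 [p1 [p2 [e1 e2 e3 e4 e5]]]]].
by apply/coproduct2P; exists i2, i1, p2, p1; split; rewrite // addrC.
Qed.

End Preadditive.

(** Hom(X, Y) = 0. *)
Definition hom0 (C : preadditive) (X Y : C) : Prop := forall f : Hom X Y, f = 0.

(** * Krull-Schmidt categories and their subcategories *)

Section Closure.
Variable C : preadditive.
Implicit Types (X Y Z W : C) (D M : set C).
Hypothesis coprod : forall (I : finType) (X : I -> C),
  exists S, is_coproduct X S.
Hypothesis hKS : krull_schmidt C.

Lemma hom0_retractl X Y W : retract X Y -> hom0 Y W -> hom0 X W.
Proof.
by move=> [a [b ba]] h f; rewrite -[f]compm1 -ba compA (h (f \o b)) comp0m.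
Qed.

Lemma hom0_retractr X Y W : retract X Y -> hom0 W Y -> hom0 W X.
Proof.
by move=> [a [b ba]] h f; rewrite -[f]comp1m -ba -compA (h (a \o f)) compm0.
Qed.

Lemma zero_exists : exists Z : C, is_zero Z.
Proof.
have [S /coproductP [iota [pi [_ _ sum1]]]] :=
  coprod (fun x : void => match x with end).
by exists S; apply/is_zeroP; rewrite -sum1 big1 // => -[].
Qed.

Lemma coproduct2_exists X Y : exists S, is_coproduct2 X Y S.
Proof. exact: coprod. Qed.

(** The summands other than X i have a coproduct R, and S is X i + R. *)
Lemma coproduct_complement n (X : 'I_n -> C) S (i : 'I_n) :
  is_coproduct X S -> exists R, is_coproduct2 (X i) R S.
Proof.
move: n X i => [|n] X i; first by case: i.
move=> /coproductP [iota [pi [pii pi0 sum1]]].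
have [R /coproductP [io [pr [prii pr0 sumR]]]] :=
  coprod (fun k : 'I_n => X (lift i k)).
exists R; apply/coproduct2P.
exists (iota i), (\sum_k (iota (lift i k) \o pr k)), (pi i),
  (\sum_k (io k \o pi (lift i k))); split => //.
- rewrite comp_suml -sumR; apply: eq_bigr => k _.
  rewrite comp_sumr (bigD1 k) //= big1 ?addr0 => [|j jk].
    by rewrite -compA (compA (pi _)) pii comp1m.
  rewrite -compA (compA (pi _)) pi0 ?comp0m ?compm0 //.
  by rewrite (inj_eq lift_inj).
- rewrite comp_suml big1 // => k _.
  by rewrite -compA pi0 ?compm0 // neq_lift.
- rewrite comp_sumr big1 // => k _.
  by rewrite compA pi0 ?comp0m // eq_sym neq_lift.
- rewrite -sum1 (bigD1_ord i) //=; congr (_ + _).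
  rewrite comp_suml; apply: eq_bigr => k _.
  rewrite comp_sumr (bigD1 k) //= big1 ?addr0 => [|j jk].
    by rewrite -compA (compA (pr k)) prii comp1m.
  by rewrite -compA (compA (pr k)) pr0 // comp0m compm0.
Qed.

Lemma is_iso0 X : is_iso (0 : Hom X X) -> idm X = 0.
Proof. by move=> [g [<- _]]; rewrite compm0. Qed.

Lemma local_iso1B X (f : Hom X X) :
  local_end X -> ~ is_iso f -> is_iso (idm X - f).
Proof.
move=> [_ loc] nf; apply: contrapT => n1f; apply: (loc _ _ n1f nf).
by rewrite subrK; apply: is_iso_id.
Qed.

(** In a local ring, if a finite sum is 1 then one of its terms is a unit. *)
Lemma local_sum X (I : finType) (f : I -> Hom X X) :
  local_end X -> \sum_i f i = idm X -> exists i, is_iso (f i).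
Proof.
move=> [nz loc] sum1; apply: contrapT => none.
have : ~ is_iso (\sum_i f i).
  apply: (big_ind (fun f => ~ is_iso f)) => //; first by move/is_iso0.
  by move=> i _ fi; apply: none; exists i.
by apply; rewrite sum1; apply: is_iso_id.
Qed.

Lemma local_idem X (e : Hom X X) : local_end X -> e \o e = e ->
  e = 0 \/ e = idm X.
Proof.
move=> lX ee; have [[g [ge eg]]|ne] := pselect (is_iso e).
  by right; rewrite -[e]comp1m -ge -compA ee.
have [g [gf _]] := local_iso1B lX ne; left.
by rewrite -[e]comp1m -gf -compA compBl comp1m ee subrr compm0.
Qed.

Lemma retract_local X Y :
  idm X <> 0 -> local_end Y -> retract X Y -> isomorphic X Y.
Proof.
move=> nz lY [a [b ba]].
have [|e0|e1] := @local_idem _ (a \o b) lY; last by exists a, b.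
  by rewrite compA -(compA a) ba compm1.
by case: nz; rewrite -ba -[b \o a]compm1 -ba compA -(compA b) e0 compm0 comp0m.
Qed.

Lemma local_isomorphic X Y : isomorphic X Y -> local_end X -> local_end Y.
Proof.
move=> [f [g [gf fg]]] [nz loc].
have conj (u : Hom Y Y) : is_iso u <-> is_iso (g \o u \o f).
  split=> ui.
    apply: is_iso_comp; last by exists g.
    by apply: is_iso_comp => //; exists f.
  suff -> : u = f \o (g \o u \o f) \o g.
    apply: is_iso_comp; last by exists f.
    by apply: is_iso_comp => //; exists g.
  by rewrite !compA fg comp1m -compA fg compm1.
split=> [Y0|u v].
  by apply: nz; rewrite -gf -[f]comp1m Y0 comp0m compm0.
rewrite !conj => nu nv uv; apply: (loc _ _ nu nv).
by rewrite -compDl -compDr.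
Qed.

Lemma local_indecomposable X : local_end X -> indecomposable X.
Proof.
move=> lX; split=> [/is_zeroP|Y Z /coproduct2P]; first by case: lX.
move=> [i1 [i2 [p1 [p2 [e1 e2 e3 e4 e5]]]]].
have [|z|z] := @local_idem _ (i1 \o p1) lX.
- by rewrite compA -(compA i1) e1 compm1.
- left; apply/is_zeroP; rewrite -e1 -[p1 \o i1]comp1m -e1 compA -(compA p1) z.
  by rewrite compm0 comp0m.
right; apply/is_zeroP.
have z2 : i2 \o p2 = 0 by apply: (addrI (i1 \o p1)); rewrite e5 z addr0.
by rewrite -e2 -[p2 \o i2]comp1m -e2 compA -(compA p2) z2 compm0 comp0m.
Qed.

Lemma krull_schmidt_ord X : exists n (Y : 'I_n -> C),
  (forall i, local_end (Y i)) /\ is_coproduct Y X.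
Proof.
have [I [Y [lY /coproductP [iota [pi [pii pi0 sum1]]]]]] := hKS X.
exists #|I|, (fun k => Y (enum_val k)); split=> //.
apply/coproductP; exists (fun k => iota (enum_val k)), (fun k => pi (enum_val k)).
split=> // [i j ij|]; first by apply: pi0; rewrite (inj_eq enum_val_inj).
rewrite -sum1 (reindex (fun k : 'I_#|I| => enum_val k)) //=.
exact: onW_bij (enum_val_bij I).
Qed.

Lemma indecomposable_local X : indecomposable X -> local_end X.
Proof.
move=> [nz ind]; have [[|n] [Y [lY cY]]] := krull_schmidt_ord X.
  have /coproductP [iota [pi [_ _ sum1]]] := cY.
  by case: nz; apply/is_zeroP; rewrite -sum1 big_ord0.
have [R YR] := coproduct_complement ord0 cY.
have /is_zeroP R0 : is_zero R.
  have [/is_zeroP Y0|//] := ind _ _ YR.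
  by case: (lY ord0).
apply: local_isomorphic (lY ord0).
have /coproduct2P [i1 [i2 [p1 [p2 [e1 e2 e3 e4 e5]]]]] := YR.
exists i1, p1; split=> //.
by rewrite -e5 -[i2 \o p2]compm1 -[p2]comp1m R0 comp0m compm0 comp0m addr0.
Qed.

(** Here closure under direct summands, which come with a complement, is
    upgraded to closure under retracts: a local summand of a retract X of Y is
    isomorphic to one of the local summands of Y. *)
Lemma subcat_retract D X Y : is_subcategory D -> retract X Y -> D Y -> D X.
Proof.
move=> [Diso Dcop Dsum] [a [b ba]] DY.
have [n [X' [lX cX]]] := krull_schmidt_ord X.
have [m [Y' [lY cY]]] := krull_schmidt_ord Y.
apply: (Dcop _ _ _ cX) => i.
have /coproductP [ix [px [pxi _ _]]] := cX.
have /coproductP [iy [py [pyi _ sumy]]] := cY.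
have [j [g [gl _]]] :
    exists j, is_iso (px i \o b \o (iy j \o py j) \o a \o ix i).
  apply: local_sum (lX i) _.
  rewrite -!comp_suml -comp_sumr sumy compm1.
  by rewrite -(compA (px i)) ba compm1 pxi.
have XY : isomorphic (X' i) (Y' j).
  apply: retract_local (lY j) _; first by case: (lX i).
  exists (py j \o a \o ix i), (g \o (px i \o b \o iy j)).
  by rewrite -gl !compA.
apply: Diso (isomorphic_sym XY) _.
by have [R YR] := coproduct_complement j cY; apply: Dsum YR DY.
Qed.

Lemma subcat_zero D : is_subcategory D -> exists2 Z, is_zero Z & D Z.
Proof.
move=> [_ Dcop _]; pose X (x : void) : C := match x with end.
have [S cS] := coprod X; exists S; last by apply: Dcop cS _ => -[].
have /coproductP [iota [pi [_ _ sum1]]] := cS.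
by apply/is_zeroP; rewrite -sum1 big1 // => -[].
Qed.

Lemma subcat_coproduct2 D X Y S :
  is_subcategory D -> is_coproduct2 X Y S -> D X -> D Y -> D S.
Proof. by move=> [_ Dcop _] cS DX DY; apply: Dcop cS _ => -[]. Qed.

(** Binary coproducts suffice, since the identity of a finite coproduct is a
    sum of maps factoring through the terms. *)
Lemma subcat_intro D :
  (exists Z, D Z) ->
  (forall X Y S, is_coproduct2 X Y S -> D X -> D Y -> D S) ->
  (forall X Y, retract X Y -> D Y -> D X) ->
  is_subcategory D.
Proof.
move=> [Z0 DZ0] Dcop Dret; split.
- by move=> X Y XY; apply: Dret; apply/isomorphic_retract/isomorphic_sym.
- move=> I X S /coproductP [iota [pi [_ _ sum1]]] DX.
  have [W [a [b [DW ba]]]] : exists W (a : Hom S W) (b : Hom W S),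
      D W /\ b \o a = \sum_i (iota i \o pi i).
    elim: (index_enum I) => [|i r [W [a [b [DW ba]]]]].
      by exists Z0, 0, 0; rewrite big_nil comp0m.
    have [V cV] := coproduct2_exists W (X i).
    have /coproduct2P [i1 [i2 [p1 [p2 [e1 e2 e3 e4 e5]]]]] := cV.
    exists V, ((i1 \o a) + (i2 \o pi i)), ((b \o p1) + (iota i \o p2)).
    split; first exact: Dcop cV DW (DX i).
    rewrite big_cons -ba compDl !compDr -!compA.
    rewrite (compA p1) e1 comp1m (compA p1) e4 comp0m compm0 addr0.
    by rewrite (compA p2) e3 comp0m compm0 add0r (compA p2) e2 comp1m addrC.
  by apply: Dret DW; exists a, b; rewrite ba.
- by move=> X Y S /coproduct2_retractl; apply: Dret.
Qed.

Lemma hom0_coproductl X Y S W :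
  is_coproduct2 X Y S -> hom0 X W -> hom0 Y W -> hom0 S W.
Proof.
move=> /coproduct2P [i1 [i2 [p1 [p2 [_ _ _ _ e]]]]] hX hY f.
rewrite -[f]compm1 -e compDr !compA (hX (f \o i1)) (hY (f \o i2)).
by rewrite !comp0m addr0.
Qed.

Lemma hom0_coproductr X Y S W :
  is_coproduct2 X Y S -> hom0 W X -> hom0 W Y -> hom0 W S.
Proof.
move=> /coproduct2P [i1 [i2 [p1 [p2 [_ _ _ _ e]]]]] hX hY f.
rewrite -[f]comp1m -e compDl -!compA (hX (p1 \o f)) (hY (p2 \o f)).
by rewrite !compm0 addr0.
Qed.

Lemma subcat_lperp (G : set C) :
  is_subcategory [set Z | forall W, G W -> hom0 Z W].
Proof.
apply: subcat_intro => /=.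
- by have [Z Z0] := zero_exists; exists Z => W _; case: (Z0 W).
- by move=> X Y S cS hX hY W GW; apply: hom0_coproductl cS (hX _ GW) (hY _ GW).
- by move=> X Y XY hY W GW; apply: hom0_retractl XY (hY _ GW).
Qed.

Lemma subcat_rperp (G : set C) :
  is_subcategory [set Z | forall W, G W -> hom0 W Z].
Proof.
apply: subcat_intro => /=.
- by have [Z Z0] := zero_exists; exists Z => W _; case: (Z0 W).
- by move=> X Y S cS hX hY W GW; apply: hom0_coproductr cS (hX _ GW) (hY _ GW).
- by move=> X Y XY hY W GW; apply: hom0_retractr XY (hY _ GW).
Qed.

Lemma add_sub (G D : set C) : is_subcategory D -> G `<=` D -> add G `<=` D.
Proof. exact: smallest_sub. Qed.

Lemma sub_add (G : set C) : G `<=` add G.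
Proof. exact: sub_gen_smallest. Qed.

Lemma subcat_add (G : set C) : is_subcategory (add G).
Proof.
split.
- move=> X Y XY aX D [Dsub GD]; have := aX D (conj Dsub GD).
  by case: Dsub => + _ _; apply.
- move=> I X S cS aX D [Dsub GD].
  have DX i := aX i D (conj Dsub GD).
  by case: Dsub => _ Dcop _; apply: Dcop cS DX.
- move=> X Y S cS aS D [Dsub GD]; have DS := aS D (conj Dsub GD).
  by case: Dsub => _ _ Dsum; apply: Dsum cS DS.
Qed.

(** M_X consists of the objects of M that do not have X as a retract. *)
Lemma is_remove_exists M X :
  is_subcategory M -> M X -> indecomposable X -> exists D, is_remove M X D.
Proof.
move=> sM MX iX; have lX := indecomposable_local iX.
have [Miso Mcop Msum] := sM.
exists [set Z | M Z /\ ~ retract X Z]; split; first split => /=.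
- move=> Y Z YZ [MY nY]; split; first exact: Miso YZ MY.
  move=> XZ; apply: nY; apply: retract_trans XZ _.
  exact/isomorphic_retract/isomorphic_sym.
- move=> I Y S cS DY; split; first by apply: Mcop cS _ => i; case: (DY i).
  move=> [a [b ba]]; have /coproductP [iota [pi [_ _ sum1]]] := cS.
  have [i [g [gl _]]] : exists i, is_iso (b \o (iota i \o pi i) \o a).
    by apply: local_sum lX _; rewrite -comp_suml -comp_sumr sum1 compm1 ba.
  case: (DY i) => _; apply; exists (pi i \o a), (g \o (b \o iota i)).
  by rewrite -gl !compA.
- move=> Y Z S cS [MS nS]; split; first exact: Msum cS MS.
  move=> XY; apply: nS; apply: retract_trans XY _.
  exact: coproduct2_retractl cS.
- by move=> Z [].
apply/seteqP; split=> Z /=.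
  by move=> [[MZ nZ] iZ]; split=> // /isomorphic_retract.
move=> [[MZ iZ] nZ]; split=> //; split=> // XZ; apply: nZ.
apply: retract_local XZ; last exact: indecomposable_local.
by case: lX.
Qed.

(** A subcategory is determined by its indecomposable objects. *)
Lemma subcat_ind_sub (D D' : set C) :
  is_subcategory D -> is_subcategory D' -> ind D `<=` ind D' -> D `<=` D'.
Proof.
move=> sD sD' DD' Z DZ; have [n [Y [lY cY]]] := krull_schmidt_ord Z.
have [_ Dcop _] := sD'; apply: (Dcop _ _ _ cY) => i.
suff /DD' [] : ind D (Y i) by [].
split; last exact: local_indecomposable.
have [_ _ Dsum] := sD.
by have [R YR] := coproduct_complement i cY; apply: Dsum YR DZ.
Qed.

(** The subcategory M_X is determined by M and the isomorphism class of X. *)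
Lemma is_remove_isomorphic M X X' D D' : isomorphic X X' ->
  is_remove M X D -> is_remove M X' D' -> D = D'.
Proof.
move=> XX' [sD _ iD] [sD' _ iD'].
have e : ind D = ind D'.
  rewrite iD iD'; congr (_ `\` _); apply/seteqP; split=> Z /=.
    exact: isomorphic_trans (isomorphic_sym XX').
  exact: isomorphic_trans XX'.
by apply/seteqP; split; apply: subcat_ind_sub; rewrite ?e.
Qed.

Lemma is_remove_notin M X D : is_remove M X D -> indecomposable X -> ~ D X.
Proof.
move=> [_ _ iD] iX DX; have : ind D X by split.
by rewrite iD => -[_]; apply; apply: isomorphic_refl.
Qed.

End Closure.

(** * A self-dual weakening of triangulated categories *)

(** Triangles are recorded without their third morphism: [tri f g] says that f
    and g are the first two morphisms of some triangle X -> Y -> Z -> X[1].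
    The operations [susp] and [desusp], that is [1] and [-1], act on objects
    only.  The fields come in dual pairs or are self-dual; [tri_comp0],
    [tri_wker] and [tri_wcok] are the exactness of Hom in both variables,
    [tri_oct] and [tri_octV] are the octahedral axiom for cones and for
    cocones, [tri_hom0] and [tri_hom0V] are the parts of the long exact
    sequences where the functoriality of the shift matters, and [tri_retract]
    and [tri_retractV] say that a retract of a morphism has a retract of the
    cone as its cone, and similarly for cocones. *)
Record wtri := Wtri {
  wcat :> preadditive;
  wcoproducts : forall (I : finType) (X : I -> wcat),
    exists S, is_coproduct X S;
  susp : wcat -> wcat;
  desusp : wcat -> wcat;
  susp_iso : forall X Y, isomorphic X Y -> isomorphic (susp X) (susp Y);
  desusp_iso : forall X Y, isomorphic X Y -> isomorphic (desusp X) (desusp Y);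
  suspK : forall X, isomorphic (desusp (susp X)) X;
  desuspK : forall X, isomorphic (susp (desusp X)) X;
  desusp_adj : forall X Y, hom0 (desusp X) Y <-> hom0 X (susp Y);
  tri : forall X Y Z : wcat, Hom X Y -> Hom Y Z -> Prop;
  tri_comp0 : forall X Y Z (f : Hom X Y) (g : Hom Y Z), tri f g -> g \o f = 0;
  tri_wker : forall X Y Z (f : Hom X Y) (g : Hom Y Z) W (h : Hom W Y),
    tri f g -> g \o h = 0 -> exists l, f \o l = h;
  tri_wcok : forall X Y Z (f : Hom X Y) (g : Hom Y Z) W (h : Hom Y W),
    tri f g -> h \o f = 0 -> exists l, l \o g = h;
  tri_cone : forall X Y (f : Hom X Y), exists Z (g : Hom Y Z), tri f g;
  tri_fib : forall Y Z (g : Hom Y Z), exists X (f : Hom X Y), tri f g;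
  tri_rot : forall X Y Z (f : Hom X Y) (g : Hom Y Z),
    tri f g -> exists h : Hom Z (susp X), tri g h;
  tri_rotV : forall X Y Z (f : Hom X Y) (g : Hom Y Z),
    tri f g -> exists h : Hom (desusp Z) X, tri h f;
  tri_id : forall X Z, is_zero Z -> tri (idm X) (0 : Hom X Z);
  tri_idV : forall X Z, is_zero Z -> tri (0 : Hom Z X) (idm X);
  tri_split : forall X Y S, is_coproduct2 X Y S ->
    exists (f : Hom X S) (g : Hom S Y), tri f g;
  tri_oct : forall X Y Z A B C (f : Hom X Y) (g : Hom Y Z)
      (a : Hom Y A) (b : Hom Z B) (c : Hom Z C),
    tri f a -> tri g b -> tri (g \o f) c ->
    exists (p : Hom A C) (q : Hom C B), tri p q;
  tri_octV : forall X Y Z A B C (f : Hom X Y) (g : Hom Y Z)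
      (a : Hom A X) (b : Hom B Y) (c : Hom C X),
    tri a f -> tri b g -> tri c (g \o f) ->
    exists (p : Hom A C) (q : Hom C B), tri p q;
  tri_hom0 : forall X Y Z (f : Hom X Y) (g : Hom Y Z) W, tri f g ->
    (forall q : Hom X W, exists q', q' \o f = q) ->
    hom0 Y (susp W) -> hom0 Z (susp W);
  tri_hom0V : forall X Y Z (f : Hom X Y) (g : Hom Y Z) W, tri f g ->
    (forall q : Hom W Z, exists q', g \o q' = q) ->
    hom0 (desusp W) Y -> hom0 (desusp W) X;
  tri_retract : forall X Y Z X' Y' Z' (f : Hom X Y) (g : Hom Y Z)
      (f' : Hom X' Y') (g' : Hom Y' Z')
      (a : Hom X X') (b : Hom Y Y') (a' : Hom X' X) (b' : Hom Y' Y),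
    tri f g -> tri f' g' -> a' \o a = idm X -> b' \o b = idm Y ->
    f' \o a = b \o f -> f \o a' = b' \o f' -> retract Z Z';
  tri_retractV : forall X Y Z X' Y' Z' (f : Hom X Y) (g : Hom Y Z)
      (f' : Hom X' Y') (g' : Hom Y' Z')
      (b : Hom Y Y') (c : Hom Z Z') (b' : Hom Y' Y) (c' : Hom Z' Z),
    tri f g -> tri f' g' -> b' \o b = idm Y -> c' \o c = idm Z ->
    g' \o b = c \o g -> g \o b' = c' \o g' -> retract X X'
}.

Section Opposite.

(** The opposite category. *)
Definition opcat (C : preadditive) : preadditive.
Proof.
exists (obj C) (fun X Y => Hom Y X) (@idm C) (fun X Y Z g f => f \o g).
- by move=> W X Y Z h g f; rewrite compA.
- by move=> X Y f; rewrite compm1.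
- by move=> X Y f; rewrite comp1m.
- by move=> X Y Z g g' f; rewrite compDr.
- by move=> X Y Z g f f'; rewrite compDl.
Defined.

Variable C : preadditive.

Lemma is_iso_op X Y (f : @Hom C X Y) : @is_iso (opcat C) Y X f <-> is_iso f.
Proof. by split=> -[g [e1 e2]]; exists g. Qed.

Lemma isomorphic_op (X Y : C) : @isomorphic (opcat C) X Y <-> isomorphic X Y.
Proof.
by split=> -[f [g [e1 e2]]]; [exists g, f|exists g, f].
Qed.

Lemma retract_op (X Y : C) : @retract (opcat C) X Y <-> retract X Y.
Proof. by split=> -[a [b ba]]; exists b, a. Qed.

Lemma is_zero_op (X : C) : @is_zero (opcat C) X <-> is_zero X.
Proof. by rewrite !is_zeroP. Qed.

Lemma is_coproduct_op (I : finType) (X : I -> C) S :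
  @is_coproduct (opcat C) I X S <-> is_coproduct X S.
Proof.
rewrite !coproductP; split=> -[i [p [e1 e2 e3]]]; exists p, i; split=> //;
  by move=> j k jk; apply: e2; rewrite eq_sym.
Qed.

Lemma local_end_op (X : C) : @local_end (opcat C) X <-> local_end X.
Proof.
split=> -[nz loc]; split=> // f g nf ng fg; apply: (loc f g);
  by [move/is_iso_op|apply/is_iso_op].
Qed.

Lemma krull_schmidt_op : krull_schmidt C -> krull_schmidt (opcat C).
Proof.
move=> hKS X; have [I [Y [lY cY]]] := hKS X; exists I, Y; split.
  by move=> i; apply/local_end_op.
exact/is_coproduct_op.
Qed.

Lemma is_coproduct2_op (X Y S : C) :
  @is_coproduct2 (opcat C) X Y S <-> is_coproduct2 X Y S.
Proof. exact: is_coproduct_op. Qed.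

Lemma indecomposable_op : @indecomposable (opcat C) = @indecomposable C.
Proof.
apply/funext => X; apply/propext; split=> -[nz ind]; split.
- by move/is_zero_op.
- move=> Y Z /is_coproduct2_op /ind.
  by case=> /is_zero_op; [left|right].
- by move/is_zero_op.
- move=> Y Z /is_coproduct2_op /ind.
  by case=> /is_zero_op; [left|right].
Qed.

Lemma is_subcategory_op : @is_subcategory (opcat C) = @is_subcategory C.
Proof.
apply/funext => D; apply/propext; split=> -[Diso Dcop Dsum]; split.
- by move=> X Y /isomorphic_op; apply: Diso.
- by move=> I X S /is_coproduct_op; apply: Dcop.
- by move=> X Y S /is_coproduct2_op; apply: Dsum.
- by move=> X Y /isomorphic_op; apply: Diso.
- by move=> I X S /is_coproduct_op; apply: Dcop.
- by move=> X Y S /is_coproduct2_op; apply: Dsum.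
Qed.

Lemma is_remove_op (M D : set C) X :
  @is_remove (opcat C) M X D <-> is_remove M X D.
Proof.
rewrite /is_remove /ind is_subcategory_op indecomposable_op.
suff -> : @isomorphic (opcat C) X = @isomorphic C X by [].
by apply/funext => Y; apply/propext/isomorphic_op.
Qed.

End Opposite.

(** The opposite structure: [1] and [-1] are exchanged and triangles are
    read backwards. *)
Definition opw (W : wtri) : wtri.
Proof.
exists (opcat W) (@desusp W) (@susp W) (fun X Y Z f g => @tri W Z Y X g f).
- move=> I X; have [S cS] := wcoproducts X.
  by exists S; apply/is_coproduct_op.
- by move=> X Y /isomorphic_op /desusp_iso /isomorphic_op.
- by move=> X Y /isomorphic_op /susp_iso /isomorphic_op.
- by move=> X; apply/isomorphic_op/desuspK.
- by move=> X; apply/isomorphic_op/suspK.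
- by move=> X Y; apply: iff_sym; apply: desusp_adj.
- by move=> X Y Z f g; apply: tri_comp0.
- by move=> X Y Z f g A h; apply: tri_wcok.
- by move=> X Y Z f g A h; apply: tri_wker.
- by move=> X Y f; apply: tri_fib.
- by move=> X Y f; apply: tri_cone.
- by move=> X Y Z f g; apply: tri_rotV.
- by move=> X Y Z f g; apply: tri_rot.
- by move=> X Z /is_zero_op; apply: tri_idV.
- by move=> X Z /is_zero_op; apply: tri_id.
- move=> X Y S /is_coproduct2_op /coproduct2_sym /tri_split [f [g fg]].
  by exists g, f.
- move=> X Y Z A B C f g a b c fa gb gfc.
  by have [p [q pq]] := tri_octV gb fa gfc; exists q, p.
- move=> X Y Z A B C f g a b c fa gb gfc.
  by have [p [q pq]] := tri_oct gb fa gfc; exists q, p.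
- by move=> X Y Z f g A; apply: tri_hom0V.
- by move=> X Y Z f g A; apply: tri_hom0.
- move=> X Y Z X' Y' Z' f g f' g' a b a' b' fg fg' aa bb e e'.
  apply/retract_op.
  exact: (tri_retractV (b := b') (b' := b) (c := a') (c' := a) fg fg').
- move=> X Y Z X' Y' Z' f g f' g' a b a' b' fg fg' aa bb e e'.
  apply/retract_op.
  exact: (tri_retract (a := b') (a' := b) (b := a') (b' := a) fg fg').
Defined.

(** * Vanishing of Hom groups along triangles *)

Section Weak.
Variable W : wtri.
Implicit Types (X Y Z A B V : W) (M N D G P Q L : set W).

(** There is a triangle X -> Y -> Z. *)
Definition tri_obj X Y Z := exists (f : Hom X Y) (g : Hom Y Z), tri f g.

Lemma tri_obj_rot X Y Z : tri_obj X Y Z -> tri_obj Y Z (susp X).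
Proof. by move=> [f [g /tri_rot [h gh]]]; exists g, h. Qed.

Lemma tri_obj_rotV X Y Z : tri_obj X Y Z -> tri_obj (desusp Z) X Y.
Proof. by move=> [f [g /tri_rotV [h hf]]]; exists h, f. Qed.

Lemma tri_obj_susp X Y Z : tri_obj X Y Z -> tri_obj (susp X) (susp Y) (susp Z).
Proof. by move=> /tri_obj_rot /tri_obj_rot /tri_obj_rot. Qed.

Lemma tri_obj_desusp X Y Z :
  tri_obj X Y Z -> tri_obj (desusp X) (desusp Y) (desusp Z).
Proof. by move=> /tri_obj_rotV /tri_obj_rotV /tri_obj_rotV. Qed.

Lemma tri_obj_iter i X Y Z :
  tri_obj X Y Z ->
  tri_obj (iter i (@susp W) X) (iter i (@susp W) Y) (iter i (@susp W) Z).
Proof. by move=> t; elim: i => //= i; apply: tri_obj_susp. Qed.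

Lemma hom0_isol X Y Z : isomorphic X Y -> hom0 X Z <-> hom0 Y Z.
Proof.
move=> XY; split; apply: hom0_retractl; apply: isomorphic_retract => //.
exact: isomorphic_sym.
Qed.

Lemma hom0_isor X Y Z : isomorphic X Y -> hom0 Z X <-> hom0 Z Y.
Proof.
move=> XY; split; apply: hom0_retractr; apply: isomorphic_retract => //.
exact: isomorphic_sym.
Qed.

Lemma hom0_susp X Y : hom0 (susp X) (susp Y) <-> hom0 X Y.
Proof. by rewrite -desusp_adj (hom0_isol _ (suspK X)). Qed.

Lemma hom0_desusp X Y : hom0 (desusp X) (desusp Y) <-> hom0 X Y.
Proof. by rewrite desusp_adj (hom0_isor _ (desuspK Y)). Qed.

Lemma desusp_adj_iter i X Y :
  hom0 (iter i (@desusp W) X) Y <-> hom0 X (iter i (@susp W) Y).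
Proof. by elim: i X Y => //= i IH X Y; rewrite desusp_adj IH -iterSr. Qed.

Lemma tri_hom0_midr X Y Z V : tri_obj X Y Z -> hom0 V X -> hom0 V Z -> hom0 V Y.
Proof.
move=> [f [g fg]] hX hZ k; have [l <-] := tri_wker fg (hZ (g \o k)).
by rewrite (hX l) compm0.
Qed.

Lemma tri_hom0_midl X Y Z V : tri_obj X Y Z -> hom0 X V -> hom0 Z V -> hom0 Y V.
Proof.
move=> [f [g fg]] hX hZ k; have [l <-] := tri_wcok fg (hX (k \o f)).
by rewrite (hZ l) comp0m.
Qed.

Lemma tri_hom0_coner X Y Z V :
  tri_obj X Y Z -> hom0 V Y -> hom0 V (susp X) -> hom0 V Z.
Proof. by move=> /tri_obj_rot; apply: tri_hom0_midr. Qed.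

Lemma tri_hom0_conel X Y Z V :
  tri_obj X Y Z -> hom0 Y V -> hom0 (susp X) V -> hom0 Z V.
Proof. by move=> /tri_obj_rot; apply: tri_hom0_midl. Qed.

Lemma tri_obj_id X Z : is_zero Z -> tri_obj X X Z.
Proof. by move=> Z0; exists (idm X), 0; apply: tri_id. Qed.

Lemma retract_susp X Y : retract X Y -> retract (susp X) (susp Y).
Proof.
move=> [a [b ba]]; have [Z Z0] := zero_exists (@wcoproducts W).
have [h t] := tri_rot (tri_id X Z0); have [h' t'] := tri_rot (tri_id Y Z0).
apply: (tri_retract (a := a) (b := idm Z) (a' := b) (b' := idm Z) t t') => //.
- by rewrite comp1m.
- by rewrite comp1m comp0m.
- by rewrite comp1m comp0m.
Qed.

End Weak.

Lemma retract_desusp (W : wtri) (X Y : W) :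
  retract X Y -> retract (desusp X) (desusp Y).
Proof. by move=> /retract_op /(@retract_susp (opw W)) /retract_op. Qed.

(** * Iterated extensions *)

Section Extensions.
Variable W : wtri.
Implicit Types (X Y Z A B V : W) (M N D G P Q L : set W).

(** The objects with a finite filtration with subquotients in G, built by
    adding one term of G on the left at a time. *)
Inductive ext G : W -> Prop :=
| ext_zero Z : is_zero Z -> ext G Z
| ext_cons X V V' : G X -> ext G V' -> tri_obj X V V' -> ext G V.

Lemma ext_lperp G V Y : (forall X, G X -> hom0 X Y) -> ext G V -> hom0 V Y.
Proof.
move=> h; elim=> [Z Z0|X V1 V' GX _ IH t]; first by case: (Z0 Y).
exact: tri_hom0_midl t (h _ GX) IH.
Qed.

Lemma ext_rperp G V Y : (forall X, G X -> hom0 Y X) -> ext G V -> hom0 Y V.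
Proof.
move=> h; elim=> [Z Z0|X V1 V' GX _ IH t]; first by case: (Z0 Y).
exact: tri_hom0_midr t (h _ GX) IH.
Qed.

Lemma tri_zerol X Y Z : is_zero X -> tri_obj X Y Z -> isomorphic Y Z.
Proof.
move=> X0 [f [g fg]].
have mono V (h : Hom V Y) : g \o h = 0 -> h = 0.
  by move=> /(tri_wker fg) [l <-]; have [_ z] := X0 V; rewrite (z l) compm0.
have [d gd] := tri_rot fg.
have sX0 : hom0 (susp X) (susp X) by apply/hom0_susp; case: (X0 X).
have d0 : d = 0 by rewrite -[d]comp1m (sX0 (idm _)) comp0m.
have [s gs] : exists s, g \o s = idm Z.
  by apply: (tri_wker gd); rewrite d0 comp0m.
exists g, s; split=> //; apply/eqP; rewrite -subr_eq0; apply/eqP/mono.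
by rewrite compBr compA gs comp1m compm1 subrr.
Qed.

Lemma ext_iso0 G X Y Z : (forall X Y, isomorphic X Y -> G X -> G Y) ->
  is_zero X -> ext G Z -> tri_obj X Y Z -> ext G Y.
Proof.
move=> Giso X0 [{}Z Z0 t|m {}Z V' Gm eV' [f [g fg]] [u [v uv]]].
  apply: ext_zero; have YZ := tri_zerol X0 t.
  apply/is_zeroP; apply: (hom0_retractl (isomorphic_retract YZ)).
  by case: (Z0 Y).
have [k [c ck]] := tri_fib (g \o v).
have [p [q pq]] := tri_octV uv fg ck.
have km : isomorphic k m by apply: tri_zerol X0 _; exists p, q.
apply: ext_cons eV' _; last by exists c, (g \o v).
exact: Giso (isomorphic_sym km) Gm.
Qed.

(** The octahedral axiom makes this class closed under extensions. *)
Lemma ext_ext G X Y Z : (forall X Y, isomorphic X Y -> G X -> G Y) ->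
  ext G X -> ext G Z -> tri_obj X Y Z -> ext G Y.
Proof.
move=> Giso eX; elim: eX Y => [{}X X0|m {}X X' Gm _ IH [f [g fg]]] Y eZ.
  exact: ext_iso0.
move=> [u [v uv]]; have [Y' [c ufc]] := tri_cone (u \o f).
have [p [q pq]] := tri_oct fg uv ufc.
apply: (ext_cons Gm) (_ : tri_obj m Y Y'); last by exists (u \o f), c.
by apply: IH => //; exists p, q.
Qed.

Lemma ext_susp G V : (forall X, G X -> G (susp X)) -> ext G V -> ext G (susp V).
Proof.
move=> Gs; elim=> [Z Z0|X V1 V' GX _ IH t].
  apply: ext_zero; apply/is_zeroP.
  by have /hom0_susp := (Z0 Z).1; apply.
exact: ext_cons (Gs _ GX) IH (tri_obj_susp t).
Qed.

Lemma ext_desusp G V :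
  (forall X, G X -> G (desusp X)) -> ext G V -> ext G (desusp V).
Proof.
move=> Gs; elim=> [Z Z0|X V1 V' GX _ IH t].
  apply: ext_zero; apply/is_zeroP.
  by have /hom0_desusp := (Z0 Z).1; apply.
exact: ext_cons (Gs _ GX) IH (tri_obj_desusp t).
Qed.

(** Sorting: when Hom(P, Q[1]) = 0, the subquotients in P can be moved to the
    left of those in Q. *)
Lemma ext_decomp P Q V : (forall X Y, isomorphic X Y -> Q X -> Q Y) ->
  (forall X Y, P X -> Q Y -> hom0 X (susp Y)) -> ext (P `|` Q) V ->
  exists A B, [/\ ext P A, ext Q B & tri_obj A V B].
Proof.
move=> Qiso PQ.
elim=> [Z Z0|m {}V V' Gm _ [A' [B' [eA' eB' [u [v uv]]]]] [f [g fg]]].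
  by exists Z, Z; split; [exact: ext_zero|exact: ext_zero|apply: tri_obj_id].
case: Gm => [Pm|Qm].
  have [A [c cg]] := tri_fib (v \o g).
  have [p [q pq]] := tri_octV fg uv cg.
  exists A, B'; split=> //; last by exists c, (v \o g).
  by apply: ext_cons Pm eA' _; exists p, q.
have [d gd] := tri_rot fg.
have A'm : hom0 A' (susp m) by apply: ext_lperp eA' => X PX; apply: PQ.
have [s gs] := tri_wker gd (A'm (d \o u)).
have [B [b sb]] := tri_cone s.
have uv' : tri (g \o s) v by rewrite gs.
have [p [q pq]] := tri_oct sb gd uv'.
exists A', B; split=> //; last by exists s, b.
apply: ext_cons (_ : Q (desusp (susp m))) eB' _.
  by apply: Qiso Qm; apply/isomorphic_sym/suspK.
by apply: tri_obj_rotV; exists p, q.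
Qed.

End Extensions.

(** * Silting subcategories *)

Section Silting.
Variable W : wtri.
Implicit Types (X Y Z A B V : W) (M N D G P Q L : set W).

Local Notation "X [+ i ]" := (iter i (@susp W) X)
  (at level 1, format "X [+ i ]").
Local Notation "X [- i ]" := (iter i (@desusp W) X)
  (at level 1, format "X [- i ]").

(** M >= N, M > N, thick and silting subcategories, as in a triangulated
    category. *)
Definition wge M N : Prop :=
  forall X Y (i : nat), M X -> N Y -> (0 < i)%N -> hom0 X Y[+i].

Definition wgt M N : Prop := wge M N /\ M <> N.

Definition wthick P : Prop :=
  [/\ is_subcategory P, forall X, P (susp X) <-> P X
    & forall X Y Z, tri_obj X Y Z -> P X -> P Y -> P Z].

Definition wsilting M : Prop :=
  [/\ is_subcategory M, wge M M & smallest wthick M = setT].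

(** N is a left mutation of M at D.  Right mutations are the left mutations of
    the opposite structure. *)
Definition wmutation M D N : Prop :=
  exists cone : W -> W,
    (forall X, M X -> exists (Y : W) (f : Hom X Y) (g : Hom Y (cone X)),
        left_approx D f /\ tri f g) /\
    N = add (D `|` cone @` M).

Definition wirreducible_mutation M N : Prop :=
  exists (X : W) (D : set W),
    [/\ M X, indecomposable X, is_remove M X D & wmutation M D N].

Lemma wge_addl G N : wge G N -> wge (add G) N.
Proof.
move=> GN X Y i aX NY i0.
suff : [set Z | forall V, V = Y[+i] -> hom0 Z V] X by apply.
apply: add_sub aX => [|Z GZ V ->]; first exact/subcat_lperp/wcoproducts.
exact: GN.
Qed.

Lemma wge_addr G N : wge N G -> wge N (add G).
Proof.
move=> NG X Y i NX aY i0; apply/desusp_adj_iter.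
suff : [set Z | forall V, V = X[-i] -> hom0 V Z] Y by apply.
apply: add_sub aY => [|Z GZ V ->]; first exact/subcat_rperp/wcoproducts.
exact/desusp_adj_iter/NG.
Qed.

Lemma wge_subl M M' N : M' `<=` M -> wge M N -> wge M' N.
Proof. by move=> MM' MN X Y i /MM'; apply: MN. Qed.

Lemma wge_subr M N N' : N' `<=` N -> wge M N -> wge M N'.
Proof. by move=> NN' MN X Y i MX /NN'; apply: MN. Qed.

Lemma wge_tri_coner M X Y Z : wge M [set X] -> wge M [set Y] ->
  tri_obj X Y Z -> wge M [set Z].
Proof.
move=> MX MY t U _ i MU -> i0; apply: tri_hom0_coner (tri_obj_iter i t) _ _.
  exact: MY.
exact: (MX _ _ i.+1 MU).
Qed.

Hypothesis hKS : krull_schmidt W.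

Section Fixed.
Variable M : set W.
Hypothesis hM : wsilting M.

Let sM : is_subcategory M. Proof. by case: hM. Qed.
Let MM : wge M M. Proof. by case: hM. Qed.
Let Miso X Y : isomorphic X Y -> M X -> M Y.
Proof. by case: sM => h _ _; apply: h. Qed.

Lemma thick_ind P : wthick P -> M `<=` P -> forall X, P X.
Proof.
move=> tP MP X; have [_ _ genM] := hM.
have : smallest wthick M X by rewrite genM.
exact: (smallest_sub tP MP).
Qed.

(** The objects of M[i] for i < 0, for i > 0, and for all i. *)
Definition neg_shifts : set W :=
  [set Z | exists i X, M X /\ isomorphic Z X[-i.+1]].
Definition pos_shifts : set W :=
  [set Z | exists i X, M X /\ isomorphic Z X[+i.+1]].
Definition all_shifts : set W := (neg_shifts `|` M) `|` pos_shifts.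

Lemma neg_shifts_iso X Y : isomorphic X Y -> neg_shifts X -> neg_shifts Y.
Proof.
move=> XY [i [U [MU XU]]]; exists i, U; split=> //.
exact: isomorphic_trans (isomorphic_sym XY) XU.
Qed.

Lemma pos_shifts_iso X Y : isomorphic X Y -> pos_shifts X -> pos_shifts Y.
Proof.
move=> XY [i [U [MU XU]]]; exists i, U; split=> //.
exact: isomorphic_trans (isomorphic_sym XY) XU.
Qed.

Lemma all_shifts_iso X Y : isomorphic X Y -> all_shifts X -> all_shifts Y.
Proof.
move=> XY [[GX|GX]|GX]; [left; left|left; right|right].
- exact: neg_shifts_iso XY GX.
- exact: Miso XY GX.
- exact: pos_shifts_iso XY GX.
Qed.

Lemma all_shifts_susp X : all_shifts X -> all_shifts (susp X).
Proof.
move=> [[[[|i] [U [MU XU]]]|MX]|[i [U [MU XU]]]].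
- left; right; apply: Miso MU; apply: isomorphic_sym.
  exact: isomorphic_trans (susp_iso XU) (desuspK _).
- left; left; exists i, U; split=> //.
  exact: isomorphic_trans (susp_iso XU) (desuspK _).
- by right; exists 0%N, X; split=> //; apply: isomorphic_refl.
- by right; exists i.+1, U; split=> //; apply: susp_iso.
Qed.

Lemma all_shifts_desusp X : all_shifts X -> all_shifts (desusp X).
Proof.
move=> [[[i [U [MU XU]]]|MX]|[[|i] [U [MU XU]]]].
- by left; left; exists i.+1, U; split=> //; apply: desusp_iso.
- by left; left; exists 0%N, X; split=> //; apply: isomorphic_refl.
- left; right; apply: Miso MU; apply: isomorphic_sym.
  exact: isomorphic_trans (desusp_iso XU) (suspK _).
- right; exists i, U; split=> //.
  exact: isomorphic_trans (desusp_iso XU) (suspK _).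
Qed.

Lemma neg_shifts_perp X Y : neg_shifts X -> wge M [set Y] -> hom0 X Y.
Proof.
move=> [i [U [MU XU]]] MY; apply/(hom0_isol _ XU)/desusp_adj_iter.
exact: MY.
Qed.

Lemma pos_shifts_perp X Y : wge [set X] M -> pos_shifts Y -> hom0 X Y.
Proof.
by move=> XM [i [U [MU YU]]]; apply/(hom0_isor _ YU); apply: XM.
Qed.

Lemma wge1r Y : M Y -> wge M [set Y].
Proof. by move=> MY; apply: wge_subr MM => _ ->. Qed.

Lemma wge1l Y : M Y -> wge [set Y] M.
Proof. by move=> MY; apply: wge_subl MM => _ ->. Qed.

Lemma wge_susp N Y : wge N [set Y] -> wge N [set susp Y].
Proof.
by move=> NY X _ i NX -> i0; rewrite -iterSr; apply: NY.
Qed.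

Lemma ext_silting V : ext M V -> M V.
Proof.
elim=> [Z Z0|X {}V V' MX eV' MV' [f [g fg]]].
  have [Z1 Z10 MZ1] := subcat_zero (@wcoproducts W) sM.
  apply: Miso MZ1; exists 0, 0; rewrite !compm0.
  by move/is_zeroP: Z0 => ->; move/is_zeroP: Z10 => ->.
have [d gd] := tri_rot fg.
have d0 : d = 0 by apply: (MM MV' MX (ltn0Sn 0)).
have [s gs] : exists s, g \o s = idm V'.
  by apply: (tri_wker gd); rewrite d0 comp0m.
have [l fl] : exists l, f \o l = idm V - (s \o g).
  apply: (tri_wker fg).
  by rewrite compBr compA gs comp1m compm1 subrr.
have [S cS] := coproduct2_exists (@wcoproducts W) X V'.
have MS := subcat_coproduct2 sM cS MX MV'.
have /coproduct2P [i1 [i2 [p1 [p2 [e1 e2 e3 e4 e5]]]]] := cS.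
apply: (subcat_retract (@wcoproducts W) hKS sM _ MS).
exists ((i1 \o l) + (i2 \o g)), ((f \o p1) + (s \o p2)).
rewrite compDl !compDr -!compA (compA p1 i1) e1 comp1m (compA p1 i2) e4 comp0m.
rewrite (compA p2 i1) e3 comp0m (compA p2 i2) e2 comp1m !compm0 addr0 add0r.
by rewrite fl subrK.
Qed.

(** Retracts of iterated extensions of shifts of M form a thick subcategory. *)
Lemma retract_ext_shifts Z : exists2 V, ext all_shifts V & retract Z V.
Proof.
move: Z; apply: thick_ind => [|Z MZ]; last first.
  exists Z; last exact/isomorphic_retract/isomorphic_refl.
  have [O O0] := zero_exists (@wcoproducts W).
  by apply: ext_cons (ext_zero _ O0) (tri_obj_id _ O0); left; right.
split.
- apply: (subcat_intro (@wcoproducts W)).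
  + have [O O0] := zero_exists (@wcoproducts W); exists O, O.
      exact: ext_zero.
    exact/isomorphic_retract/isomorphic_refl.
  + move=> X Y S cS [VX eVX [a [a' aa]]] [VY eVY [b [b' bb]]].
    have [V cV] := coproduct2_exists (@wcoproducts W) VX VY.
    have /coproduct2P [i1 [i2 [p1 [p2 [e1 e2 e3 e4 e5]]]]] := cS.
    have /coproduct2P [j1 [j2 [q1 [q2 [d1 d2 d3 d4 d5]]]]] := cV.
    exists V; last first.
      exists ((j1 \o (a \o p1)) + (j2 \o (b \o p2))).
      exists ((i1 \o (a' \o q1)) + (i2 \o (b' \o q2))).
      rewrite compDl !compDr -!compA (compA q1 j1) d1 comp1m (compA q1 j2) d4.
      rewrite comp0m (compA q2 j1) d3 comp0m (compA q2 j2) d2 comp1m !compm0.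
      by rewrite addr0 add0r (compA a') aa (compA b') bb !comp1m.
    exact: ext_ext all_shifts_iso eVX eVY (tri_split cV).
  + move=> X Y XY [V eV YV]; exists V => //; exact: retract_trans XY YV.
- move=> X; split=> -[V eV XV].
    exists (desusp V); first exact: ext_desusp all_shifts_desusp eV.
    apply: retract_trans (retract_desusp XV).
    exact/isomorphic_retract/isomorphic_sym/suspK.
  by exists (susp V); [exact: ext_susp all_shifts_susp eV|exact: retract_susp].
- move=> X Y Z [f [g fg]] [VX eVX [a [a' aa]]] [VY eVY [b [b' bb]]].
  have [V [h Fh]] := tri_cone (b \o f \o a').
  exists V; last first.
    apply: (tri_retract (a := a) (b := b) (a' := a') (b' := b') fg Fh) => //.
      by rewrite -compA aa compm1.
    by rewrite !compA bb comp1m.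
  apply: ext_ext all_shifts_iso eVY (ext_susp all_shifts_susp eVX) _.
  by apply: tri_obj_rot; exists (b \o f \o a'), h.
Qed.

(** The weight decomposition: B is built from the positive shifts of M, A' from
    the negative ones, and T0 lies in M. *)
Lemma weight Z : exists V A' A T0 B,
  [/\ retract Z V, ext neg_shifts A', M T0, ext pos_shifts B
  & tri_obj A V B /\ tri_obj A' A T0].
Proof.
have [V eV ZV] := retract_ext_shifts Z.
have [A [B [eA eB AVB]]] : exists A B,
    [/\ ext (neg_shifts `|` M) A, ext pos_shifts B & tri_obj A V B].
  apply: ext_decomp eV; first exact: pos_shifts_iso.
  move=> X Y [nX|MX] [i [U [MU YU]]].
    apply: neg_shifts_perp nX _ => X' _ j MX' -> j0.
    apply/desusp_adj_iter/(hom0_isor _ (susp_iso YU))/desusp_adj_iter.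
    by rewrite -iterS -iterD; apply: MM => //; rewrite addn_gt0 j0.
  by apply/(hom0_isor _ (susp_iso YU)); exact: (MM MX MU (ltn0Sn i.+1)).
have [A' [T0 [eA' eT0 t]]] : exists A' T0,
    [/\ ext neg_shifts A', ext M T0 & tri_obj A' A T0].
  apply: ext_decomp eA; first exact: Miso.
  by move=> X Y nX MY; apply: neg_shifts_perp nX _; apply/wge_susp/wge1r.
by exists V, A', A, T0, B; split=> //; apply: ext_silting.
Qed.

Lemma silting_left_approx Z : wge [set Z] M ->
  exists Y (p : Hom Z Y), left_approx M p.
Proof.
move=> ZM; have [V [A' [A [T0 [B [[a [b ba]] eA' MT0 eB]]]]]] := weight Z.
move=> [[u [v uv]] [f [g fg]]].
have [i ui] : exists i, u \o i = a.
  apply: (tri_wker uv); apply: (ext_rperp (Y := Z)) eB (v \o a) => Y pY.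
  exact: pos_shifts_perp ZM pY.
exists T0, (g \o i); split=> // Y k MY.
have [l lg] : exists l, l \o g = k \o (b \o u).
  apply: (tri_wcok fg); apply: (ext_lperp (Y := Y)) eA' _ => X nX.
  exact: neg_shifts_perp nX (wge1r MY).
by exists l; rewrite compA lg -!compA ui ba compm1.
Qed.

Lemma silting_right_approx Z : wge M [set Z] ->
  exists Y (p : Hom Y Z), right_approx M p.
Proof.
move=> MZ; have [V [A' [A [T0 [B [[a [b ba]] eA' MT0 eB]]]]]] := weight Z.
move=> [[u [v uv]] [f [g fg]]].
have [i ig] : exists i, i \o g = b \o u.
  apply: (tri_wcok fg); apply: (ext_lperp (Y := Z)) eA' _ => X nX.
  exact: neg_shifts_perp nX MZ.
exists T0, i; split=> // Y k MY.
have [l ul] : exists l, u \o l = a \o k.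
  apply: (tri_wker uv); apply: (ext_rperp (Y := Y)) eB _ => X pX.
  exact: pos_shifts_perp (wge1l MY) pX.
by exists (g \o l); rewrite compA ig -compA ul compA ba comp1m.
Qed.

(** In particular, a silting subcategory is a maximal presilting one. *)
Lemma silting_maximal Z : wge [set Z] M -> wge M [set Z] -> M Z.
Proof.
move=> ZM MZ; have [V [A' [A [T0 [B [[a [b ba]] eA' MT0 eB]]]]]] := weight Z.
move=> [[u [v uv]] [f [g fg]]].
have [i ui] : exists i, u \o i = a.
  apply: (tri_wker uv); apply: (ext_rperp (Y := Z)) eB (v \o a) => Y pY.
  exact: pos_shifts_perp ZM pY.
have [j jg] : exists j, j \o g = b \o u.
  apply: (tri_wcok fg); apply: (ext_lperp (Y := Z)) eA' _ => X nX.
  exact: neg_shifts_perp nX MZ.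
apply: (subcat_retract (@wcoproducts W) hKS sM _ MT0).
by exists (g \o i), j; rewrite compA jg -compA ui ba.
Qed.

(** This holds because X is a retract of an object built from M[<=0]; it is the
    source of the transitivity of >=. *)
Lemma silting_orthogonal X Y : wge [set X] M -> wge M [set Y] ->
  wge [set X] [set Y].
Proof.
move=> XM MY _ _ n -> -> n0.
have [V [A' [A [T0 [B [[a [b ba]] eA' MT0 eB]]]]]] := weight X.
move=> [[u [v uv]] t].
have [i ui] : exists i, u \o i = a.
  apply: (tri_wker uv); apply: (ext_rperp (Y := X)) eB (v \o a) => Z pZ.
  exact: pos_shifts_perp XM pZ.
apply: (@hom0_retractl _ _ A); first by exists i, (b \o u); rewrite -compA ui.
apply: tri_hom0_midl t _ (MY _ _ _ MT0 erefl n0).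
apply: ext_lperp eA' => Z nZ; apply: neg_shifts_perp nZ _.
by elim: {n0} n => // n IH; apply: wge_susp.
Qed.

(** Hom(Z, M[i]) vanishes for large i, uniformly in M. *)
Lemma silting_bound Z :
  exists l, forall X i, M X -> (l < i)%N -> hom0 Z X[+i].
Proof.
move: Z; apply: thick_ind => [|Z MZ]; last first.
  by exists 0%N => X i MX; apply: MM.
split.
- apply: (subcat_intro (@wcoproducts W)).
  + have [O O0] := zero_exists (@wcoproducts W).
    by exists O, 0%N => X i _ _; case: (O0 X[+i]).
  + move=> X Y S cS [l hl] [m hm]; exists (maxn l m) => Z i MZ.
    rewrite gtn_max => /andP [li mi].
    exact: hom0_coproductl cS (hl _ _ MZ li) (hm _ _ MZ mi).
  + move=> X Y XY [l hl]; exists l => Z i MZ li.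
    exact: hom0_retractl XY (hl _ _ MZ li).
- move=> X; split=> -[l hl].
    by exists l => Z i MZ li; apply/hom0_susp; apply: (hl Z i.+1) => //; apply: ltnW.
  by exists l.+1 => Z [//|i] MZ li; apply/hom0_susp/hl.
- move=> X Y Z t [l hl] [m hm]; exists (maxn l.+1 m) => U [//|i] MU.
  rewrite gtn_max => /andP [li mi].
  apply: tri_hom0_conel t (hm _ _ MU mi) _.
  exact/hom0_susp/hl.
Qed.

End Fixed.
End Silting.

(** * Approximations with few summands *)

Section Families.
Variable C : preadditive.
Hypothesis hKS : krull_schmidt C.
Implicit Types (X Y Z V : C) (M : set C).

(** The components Z -> X i of a left M-approximation of Z whose target is
    the coproduct of the local objects X i. *)
Definition left_family M Z n (X : 'I_n -> C) (p : forall i, Hom Z (X i)) : Prop :=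
  (forall i, local_end (X i) /\ M (X i)) /\
  forall V (t : Hom Z V), M V ->
    exists h : forall i, Hom (X i) V, t = \sum_i (h i \o p i).

Lemma nat_min (P : nat -> Prop) : (exists n, P n) ->
  exists n, P n /\ forall m, (m < n)%N -> ~ P m.
Proof.
move=> [n Pn]; have ex : exists n, `[< P n >] by exists n; apply/asboolP.
exists (ex_minn ex); case: ex_minnP => m /asboolP Pm min; split=> // k km Pk.
by have := min k (asboolT Pk); rewrite leqNgt km.
Qed.

Hypothesis coprod : forall (I : finType) (X : I -> C),
  exists S, is_coproduct X S.

(** A left approximation with the least number of local summands is
    irredundant: if one component is a combination of all of them, its own
    coefficient is invertible, for otherwise it could be dropped.  This
    replaces the theory of minimal morphisms and radicals. *)
Lemma irredundant_left_family M Z : is_subcategory M ->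
  (exists Y (f : Hom Z Y), left_approx M f) ->
  exists n (X : 'I_n -> C) (p : forall i, Hom Z (X i)),
    left_family M p /\
    forall i (u : forall j, Hom (X j) (X i)),
      p i = \sum_j (u j \o p j) -> is_iso (u i).
Proof.
move=> sM [Y [f [MY fY]]].
pose P n := exists (X : 'I_n -> C) (p : forall i, Hom Z (X i)), left_family M p.
have [|n [[X [p [MX pX]]] min]] := @nat_min P.
  have [n [X [lX cX]]] := krull_schmidt_ord hKS Y.
  have /coproductP [iota [pi [_ _ sum1]]] := cX.
  exists n, X, (fun i => pi i \o f); split=> [i|V t MV].
    split=> //; have [_ _ Msum] := sM.
    by have [R YR] := coproduct_complement coprod i cX; apply: Msum YR MY.
  have [h <-] := fY _ t MV; exists (fun i => h \o iota i).
  rewrite -[f in LHS]comp1m -sum1 comp_suml comp_sumr.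
  by apply: eq_bigr => i _; rewrite !compA.
exists n, X, p; split=> //.
case: n X p MX pX min => [|n] X p MX pX min i u pi_sum; first by case: i u pi_sum.
apply: contrapT => nu.
have [w [w1 _]] := local_iso1B (MX i).1 nu.
have pi_rest : p i = \sum_k ((w \o u (lift i k)) \o p (lift i k)).
  rewrite -[LHS]comp1m -w1 -compA compBl comp1m.
  rewrite {1}pi_sum (bigD1_ord i) //= addrC addrK comp_sumr.
  by apply: eq_bigr => k _; rewrite compA.
apply: (min n (ltnSn n)).
exists (fun k => X (lift i k)), (fun k => p (lift i k)); split=> // V t MV.
have [h ->] := pX _ t MV.
exists (fun k => (h i \o (w \o u (lift i k))) + h (lift i k)).
rewrite (bigD1_ord i) //= pi_rest comp_sumr -big_split /=.
by apply: eq_bigr => k _; rewrite compDl !compA.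
Qed.

End Families.

Lemma irredundant_right_family (C : preadditive) (M : set C) (Z : C) :
  krull_schmidt C ->
  (forall (I : finType) (X : I -> C), exists S, is_coproduct X S) ->
  is_subcategory M -> (exists Y (f : Hom Y Z), right_approx M f) ->
  exists n (X : 'I_n -> C) (g : forall i, Hom (X i) Z),
    [/\ forall i, local_end (X i) /\ M (X i),
        forall V (t : Hom V Z), M V ->
          exists h : forall i, Hom V (X i), t = \sum_i (g i \o h i)
      & forall i (u : forall j, Hom (X i) (X j)),
          g i = \sum_j (g j \o u j) -> is_iso (u i)].
Proof.
move=> hKS coprod sM [Y [f fM]].
have [|||n [X [g [[MX gX] irr]]]] :=
    @irredundant_left_family (opcat C) (krull_schmidt_op hKS) _ M Z.
- by move=> I U; have [S cS] := coprod I U; exists S; apply/is_coproduct_op.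
- by rewrite is_subcategory_op.
- by exists Y, f.
exists n, X, g; split=> //.
- by move=> i; have [/local_end_op] := MX i.
- by move=> i u /irr /is_iso_op.
Qed.

(** * Mutations *)

Section Mutation.
Variable W : wtri.
Implicit Types (X Y Z A B V : W) (M N D G P Q L : set W).
Hypothesis hKS : krull_schmidt W.

Local Notation "X [+ i ]" := (iter i (@susp W) X)
  (at level 1, format "X [+ i ]").
Local Notation "X [- i ]" := (iter i (@desusp W) X)
  (at level 1, format "X [- i ]").

Lemma wge_set1l M N X : M X -> wge M N -> wge [set X] N.
Proof. by move=> MX; apply: wge_subl => _ ->. Qed.

Lemma wge_set1r M N X : N X -> wge M N -> wge M [set X].
Proof. by move=> NX; apply: wge_subr => _ ->. Qed.

Lemma wge_trans M N L : wsilting N -> wge M N -> wge N L -> wge M L.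
Proof.
move=> hN MN NL X Y i MX LY i0.
exact: (silting_orthogonal hKS hN (wge_set1l MX MN) (wge_set1r LY NL)).
Qed.

Lemma wge_sub M N : wsilting M -> wge M N -> wge N M -> N `<=` M.
Proof.
move=> hM MN NM X NX; apply: (silting_maximal hKS hM).
  exact: wge_set1l NX NM.
exact: wge_set1r NX MN.
Qed.

Lemma wge_antisym M N : wsilting M -> wsilting N -> wge M N -> wge N M -> M = N.
Proof.
by move=> hM hN MN NM; apply/seteqP; split; apply: wge_sub.
Qed.

Section Fixed.
Variables M D : set W.
Hypotheses (hM : wsilting M) (DM : D `<=` M).

Let MM : wge M M. Proof. by case: hM. Qed.

Lemma ge_mutation N : wmutation M D N -> wge M N.
Proof.
move=> [cone [coneP ->]]; apply: wge_addr => X T i MX [DY|[Y MY <-]] i0.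
  exact: MM MX (DM DY) i0.
have [V [f [g [[DV _] fg]]]] := coneP Y MY.
apply: (@wge_tri_coner _ M Y V (cone Y)) => //.
- exact: wge_set1r MM.
- exact: wge_set1r (DM DV) MM.
- by exists f, g.
Qed.

(** If M >= L and all morphisms from M to L factor through the left
    D-approximations, then the mutation of M at D is still >= L. *)
Lemma mutation_ge N L : wmutation M D N -> wge M L ->
  (forall X Y (f : Hom X Y) V (q : Hom X V), M X -> L V -> left_approx D f ->
     exists q', q' \o f = q) -> wge N L.
Proof.
move=> [cone [coneP ->]] ML fac; apply: wge_addl => T V i [DX|[X MX <-]] LV.
  exact: ML (DM DX) LV.
have [Y [f [g [fD fg]]]] := coneP X MX.
have MY : M Y by case: fD => /DM.
case: i => [//|[|i]] _.
  apply: (tri_hom0 fg) => [q|]; first exact: fac fD.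
  exact: (ML _ _ 1%N MY LV).
have t : tri_obj X Y (cone X) by exists f, g.
apply: tri_hom0_conel t (ML _ _ i.+2 MY LV isT) _.
exact/hom0_susp/(ML _ _ i.+1 MX LV).
Qed.

(** Applied in both directions, this shows that a mutation does not depend on
    the choice of triangles; with N' = N, that it is presilting. *)
Lemma mutation_ge_mutation N N' : wmutation M D N -> wmutation M D N' -> wge N N'.
Proof.
move=> mN [cone' [cone'P ->]].
have ND : wge N D.
  apply: mutation_ge mN _ _ => [|X Y f V q MX DV [_ fD]]; first exact: wge_subr MM.
  exact: fD.
have NM X Y i : N X -> M Y -> hom0 X Y[+i.+2].
  have NsM : wge N [set V | exists2 U, M U & V = susp U].
    case: mN => cone [coneP ->]; apply: wge_addl.
    move=> T0 _ j [DU|[U MU <-]] [T MT ->] j0; rewrite -iterSr.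
      exact: MM (DM DU) MT _.
    have [V [f [g [[/DM MV _] fg]]]] := coneP U MU.
    have t : tri_obj U V (cone U) by exists f, g.
    apply: tri_hom0_conel t (MM MV MT (ltn0Sn j)) _.
    exact/hom0_susp/(MM MU MT j0).
  by move=> NX MY; rewrite iterSr; apply: NsM => //; exists Y.
apply: wge_addr => X T i NX [DV|[V MV <-]] i0; first exact: ND.
have [Y [f [g [[DY _] fg]]]] := cone'P V MV.
have t : tri_obj V Y (cone' V) by exists f, g.
apply: tri_hom0_coner (tri_obj_iter i t) (ND _ _ _ NX DY i0) _.
by case: i i0 => // i _; apply: (NM _ _ i).
Qed.

Lemma mutation_silting N : wmutation M D N -> wsilting N.
Proof.
move=> mN; split.
- by case: mN => cone [_ ->]; apply: subcat_add.
- exact: mutation_ge_mutation.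
apply/seteqP; split=> [X _ //|X _ P [tP NP]].
apply: (thick_ind hM tP) => U MU.
case: mN NP => cone [coneP ->] NP.
have [Y [f [g [[DY _] fg]]]] := coneP U MU.
have PY : P Y by apply: NP; apply: sub_add; left.
have Pc : P (cone U) by apply: NP; apply: sub_add; right; exists U.
have [h gh] := tri_rot fg.
have [_ Ps Pt] := tP; apply/Ps; apply: Pt PY Pc.
by exists g, h.
Qed.

(** If X were in N, the third morphism of X -> Y -> cone X -> X[1] would be
    zero, making X a retract of Y, hence an object of D. *)
Lemma mutation_notin N X : M X -> is_subcategory D -> ~ D X ->
  wmutation M D N -> ~ N X.
Proof.
move=> MX sD nDX mN NX; have [_ NN _] := mutation_silting mN.
case: mN NX NN => cone [coneP ->] NX NN.
have [Y [f [g [[DY _] fg]]]] := coneP X MX.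
have [h hf] := tri_rotV fg.
have h0 : h = 0.
  apply: (iffRL (desusp_adj _ _)); apply: (NN (cone X) X 1%N) => //.
  by apply: sub_add; right; exists X.
have [r rf] : exists r, r \o f = idm X.
  by apply: (tri_wcok hf); rewrite h0 compm0.
apply: nDX; apply: (subcat_retract (@wcoproducts W) hKS sD _ DY).
by exists f, r.
Qed.

Lemma mutation_exists : covariantly_finite D M -> exists N, wmutation M D N.
Proof.
move=> fin.
have [cone coneP] : {cone : W -> W & forall X, M X ->
    exists Y (f : Hom X Y) (g : Hom Y (cone X)), left_approx D f /\ tri f g}.
  apply: (@choice _ _ (fun X Z => M X -> exists Y (f : Hom X Y) (g : Hom Y Z),
    left_approx D f /\ tri f g)) => X.
  have [MX|nMX] := pselect (M X); last by exists X.
  have [Y [f fD]] := fin X MX; have [Z [g fg]] := tri_cone f.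
  by exists Z => _; exists Y, f, g.
by exists (add (D `|` cone @` M)), cone.
Qed.

End Fixed.

(** The cocone of a right M-approximation keeps Hom(M, -[>0]) = 0. *)
Lemma fibre_ge M X Y Z (f : Hom X Y) (g : Hom Y Z) : tri f g ->
  wge M [set Y] -> wge M [set Z] ->
  (forall A (q : Hom A Z), M A -> exists q', g \o q' = q) -> wge M [set X].
Proof.
move=> fg MY MZ fac A _ [//|[|i]] MA -> _.
  apply/desusp_adj; apply: (tri_hom0V fg) => [q|]; first exact: fac.
  exact/desusp_adj/(MY A Y 1%N).
have t : tri_obj Z (susp X) (susp Y).
  by apply: tri_obj_rot; apply: tri_obj_rot; exists f, g.
rewrite iterSr; apply: tri_hom0_midr (tri_obj_iter i.+1 t) _ _.
  exact: MZ.
by rewrite -iterSr; apply: MY.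
Qed.

(** Assume that Hom(Z[-l], M[>0]) = 0 and Hom(Z, N[>0]) = 0.  If a morphism p
    from Z[-l] to an object X of M with local endomorphism ring is not in the
    radical, in the sense that any factorization r q of p through M has r split
    epi, then all morphisms from X to N factor through D = M_X. *)
Lemma right_factor M N l Z X (p : Hom Z[-l] X) D V (t : Hom X V) :
  wsilting M -> wge M N -> local_end X -> M X ->
  wge [set Z[-l]] M -> wge [set Z] N -> (0 < l)%N ->
  (forall Y (q : Hom Z[-l] Y) (r : Hom Y X), M Y -> p = r \o q ->
     exists s, r \o s = idm X) ->
  is_remove M X D -> N V ->
  exists Y (a : Hom X Y) (b : Hom Y V), D Y /\ t = b \o a.
Proof.
move=> hM MN lX MX Z'M ZN l0 p_rad [sD DM iD] NV.
have [sM MM _] := hM.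
have MV : wge M [set V] := wge_set1r NV MN.
have [n [U [g [MU gU irr]]]] := irredundant_right_family hKS (@wcoproducts W) sM
  (silting_right_approx hKS hM MV).
have [T cT] := wcoproducts U.
have /coproductP [iota [pi [pii pi0 sum1]]] := cT.
have [G Gi] : exists G : Hom T V, forall i, G \o iota i = g i.
  exists (\sum_j (g j \o pi j)) => i; rewrite comp_suml (bigD1 i) //= -compA pii.
  by rewrite compm1 big1 ?addr0 // => j ji; rewrite -compA pi0 ?compm0 // eq_sym.
have [[i [phi [psi [psiphi phipsi]]]]|nU] :=
  pselect (exists i, isomorphic X (U i)); last first.
  have [h ->] := gU _ t MX.
  exists T, (\sum_i (iota i \o h i)), G; split; last first.
    by rewrite comp_sumr; apply: eq_bigr => i _; rewrite compA Gi.
  have [_ Dcop _] := sD; apply: (Dcop _ _ _ cT) => i.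
  suff [] : ind D (U i) by [].
  rewrite iD; split; last by move=> XU; apply: nU; exists i.
  by split; [case: (MU i)|apply: local_indecomposable; case: (MU i)].
(* From here on X is isomorphic to the summand U i of the right approximation
   G : T -> V of V. *)
exfalso.
have MT : M T by have [_ Mcop _] := sM; apply: (Mcop _ _ _ cT) => j; case: (MU j).
have [B [c cG]] := tri_fib G.
have MB : wge M [set B].
  apply: (fibre_ge cG) (wge_set1r MT MM) MV _ => A q MA.
  have [h ->] := gU _ q MA; exists (\sum_j (iota j \o h j)).
  by rewrite comp_sumr; apply: eq_bigr => j _; rewrite compA Gi.
have [M1 [r [MM1 rM1]]] := silting_right_approx hKS hM MB.
have [B1 [c1 c1r]] := tri_fib r.
have MB1 : wge M [set B1].
  apply: (fibre_ge c1r) (wge_set1r MM1 MM) MB _ => A q MA; exact: rM1.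
(* The composite Z[-l] -> X -> T -> V vanishes, so Z[-l] -> T lifts through
   the cocone B and then through its right approximation M1. *)
pose th := iota i \o phi \o p.
have [th' cth] : exists th', c \o th' = th.
  apply: (tri_wker cG); apply: (iffRL (desusp_adj_iter _ _ _)).
  exact: ZN.
have [d rd] := tri_rot c1r.
have [q rq] : exists q, r \o q = th'.
  apply: (tri_wker rd).
  exact: (silting_orthogonal hKS hM Z'M MB1 (i := 1%N)).
have [|s rs] := p_rad M1 q (psi \o pi i \o c \o r) MM1.
  rewrite -!compA rq cth /th !compA -(compA psi) pii compm1.
  by rewrite psiphi comp1m.
(* A section s of psi pi_i c r gives x : U i -> T with pi_i x = 1 and
   G x = 0, so the component g i is redundant. *)
pose x := c \o r \o s \o psi.
have pix : pi i \o x = idm (U i).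
  rewrite -[LHS]comp1m -phipsi /x.
  have -> : phi \o psi \o (pi i \o (c \o r \o s \o psi)) =
    phi \o (psi \o pi i \o c \o r \o s) \o psi by rewrite !compA.
  by rewrite rs compm1.
have Gx : G \o x = 0 by rewrite /x !compA (tri_comp0 cG) !comp0m.
have /is_iso0 : is_iso (0 : Hom (U i) (U i)).
  have := irr i (fun j => pi j \o (iota i - x)).
  rewrite compBr pii pix subrr; apply.
  have -> : g i = G \o idm T \o (iota i - x).
    by rewrite compm1 compBr Gi Gx subr0.
  rewrite -sum1 comp_sumr comp_suml; apply: eq_bigr => j _.
  by rewrite compA Gi compA.
by case: (MU i) => -[].
Qed.

(** Below M and above N there is an irreducible left mutation of M. *)
Lemma mutation_between M N : wsilting M -> wsilting N -> wgt M N ->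
  (forall X D, M X -> indecomposable X -> is_remove M X D ->
     covariantly_finite D M) ->
  exists X D L, [/\ M X, indecomposable X, is_remove M X D, wmutation M D L
    & wge L N].
Proof.
move=> hM hN [MN neMN] fin; have [sM MM _] := hM; have [sN NN _] := hN.
(* If N were contained in M, then M and N would be equal by antisymmetry. *)
have [Z [NZ nMZ]] : exists Z, N Z /\ ~ M Z.
  apply: contrapT => none; apply: neMN; apply: wge_antisym => //.
  apply: wge_subl MM => Z NZ; apply: contrapT => nMZ; apply: none.
  by exists Z.
(* The least l such that Hom(Z, M[i]) = 0 for all i > l. *)
have [l [hl min]] := nat_min (silting_bound hM Z).
have l0 : (0 < l)%N.
  rewrite lt0n; apply/eqP => l0; apply: nMZ; apply: (silting_maximal hKS hM).
    by move=> _ X i -> MX i0; apply: hl; rewrite ?l0.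
  exact: wge_set1r NZ MN.
have [X0 [MX0 nX0]] : exists X, M X /\ ~ hom0 Z X[+l].
  apply: contrapT => none; apply: (min l.-1); rewrite ?prednK //.
  move=> X i MX; rewrite leq_eqVlt => /orP [/eqP li|]; last exact: hl.
  by apply: contrapT; rewrite -li => nX; apply: none; exists X.
have Z'M : wge [set Z[-l]] M.
  move=> _ X i -> MX i0; apply/desusp_adj_iter; rewrite -iterD; apply: hl => //.
  by rewrite -[X in (X < _)%N]addn0 ltn_add2l.
have [n [U [p [[MU pU] irr]]]] := irredundant_left_family hKS (@wcoproducts W) sM
  (silting_left_approx hKS hM Z'M).
case: n U p MU pU irr => [|n] U p MU pU irr.
  case: nX0; apply/desusp_adj_iter => t; have [h ->] := pU _ t MX0.
  by rewrite big_ord0.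
pose X := U ord0; have [lX MX] := MU ord0.
have iX := local_indecomposable lX.
have [D rD] := is_remove_exists (@wcoproducts W) hKS sM MX iX.
have [sD DM iD] := rD.
have [L mL] := mutation_exists (fin _ _ MX iX rD).
have p_rad Y (q : Hom Z[-l] Y) (r : Hom Y X) : M Y -> p ord0 = r \o q ->
    exists s, r \o s = idm X.
  move=> MY pE; have [h qE] := pU _ q MY.
  have [w [_ w1]] : is_iso (r \o h ord0).
    apply: (irr ord0 (fun j => r \o h j)).
    rewrite [LHS]pE qE comp_sumr.
    by apply: eq_bigr => j _; rewrite compA.
  by exists (h ord0 \o w); rewrite compA.
have fac V (t : Hom X V) :=
  right_factor t hM MN lX MX Z'M (wge_set1l NZ NN) l0 p_rad rD.
exists X, D, L; split=> //.
apply: (mutation_ge DM mL MN) => A Y f V q MA NV [DY fD].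
have [m [B [lB cB]]] := krull_schmidt_ord hKS A.
have MB k : M (B k).
  have [_ _ Msum] := sM.
  by have [R BR] := coproduct_complement (@wcoproducts W) k cB; apply: Msum BR MA.
have /coproductP [iota [pi [_ _ sum1]]] := cB.
have facB k : exists h : Hom Y V, h \o f = q \o iota k \o pi k.
  have [[phi [psi [psiphi phipsi]]]|nXB] := pselect (isomorphic X (B k)).
    have [E [a [b [DE qE]]]] := fac V (q \o iota k \o phi) NV.
    have [h hf] := fD _ (a \o psi \o pi k) DE.
    exists (b \o h); rewrite -compA hf !compA -qE.
    by rewrite -(compA _ phi) phipsi compm1.
  have DB : D (B k).
    suff [] : ind D (B k) by [].
    by rewrite iD; split=> //; split=> //; apply: local_indecomposable.
  by have [h hf] := fD _ (pi k) DB; exists (q \o iota k \o h); rewrite -compA hf.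
have [h hf] := choice facB.
exists (\sum_k h k); rewrite comp_suml -[q in RHS]compm1 -sum1 comp_sumr.
by apply: eq_bigr => k _; rewrite hf compA.
Qed.

End Mutation.

(** * Irreducible mutations are the covering relations *)

Section WeakTheorem.
Variable W : wtri.
Implicit Types (X Y Z A B V : W) (M N D G P Q L : set W).
Hypothesis hKS : krull_schmidt W.
Hypothesis fin : forall M X D, wsilting M -> M X -> indecomposable X ->
  is_remove M X D -> covariantly_finite D M.

Lemma irreducible_mutationP M N : wsilting M -> wsilting N ->
  wirreducible_mutation M N <->
  wgt M N /\ ~ exists L, [/\ wsilting L, wgt M L & wgt L N].
Proof.
move=> hM hN; split=> [[X [D [MX iX rD mN]]]|[MN none]]; last first.
  have [X [D [L [MX iX rD mL LN]]]] :=
    mutation_between hKS hM hN MN (fun X D => @fin M X D hM).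
  have [sD DM _] := rD.
  have nDX := is_remove_notin rD iX.
  have hL := mutation_silting hM DM mL.
  have ML : wgt M L.
    split; first exact: ge_mutation mL.
    by move=> ML; apply: (mutation_notin hKS hM DM MX sD nDX mL); rewrite -ML.
  suff NL : N = L by rewrite NL; exists X, D.
  apply: contrapT => nNL; apply: none; exists L; split=> //; split=> // NL.
  exact/nNL/esym.
have [sD DM iD] := rD.
have nDX := is_remove_notin rD iX.
have MN : wge M N by apply: ge_mutation mN.
split.
  by split=> // e; apply: (mutation_notin hKS hM DM MX sD nDX mN); rewrite -e.
move=> [L [hL ML [LN neLN]]].
have [X' [D' [M' [MX' iX' rD' mM' M'L]]]] :=
  mutation_between hKS hM hL ML (fun X D => @fin M X D hM).
have [sD' D'M iD'] := rD'.
have [XX'|nXX'] := pselect (isomorphic X X').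
  have DD' := is_remove_isomorphic (@wcoproducts W) hKS XX' rD rD'.
  rewrite -DD' in mM'.
  apply: neLN; apply: (wge_antisym hKS) => //.
  apply: (wge_trans hKS (mutation_silting hM DM mM')) M'L.
  exact: mutation_ge_mutation mN mM'.
have hM' := mutation_silting hM D'M mM'.
have NX' : N X'.
  have [cone [_ ->]] := mN; apply: sub_add; left.
  by have [] : ind D X' by rewrite iD; split.
have nD'X' := is_remove_notin rD' iX'.
apply: (mutation_notin hKS hM D'M MX' sD' nD'X' mM').
apply: (silting_maximal hKS hM').
  exact: wge_set1l MX' (ge_mutation hM D'M mM').
exact: wge_set1r NX' (wge_trans hKS hL M'L LN).
Qed.

End WeakTheorem.

(** * Triangulated categories as weak structures *)

Section TriangulatedIsWeak.
Variable T : triangulated.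
Implicit Types (X Y Z : T).

Lemma shiftm_inj X Y : injective (@shiftm T X Y).
Proof. exact: bij_inj (shiftm_bij _ _). Qed.

Lemma shiftm_surj X Y (h : Hom (shift X) (shift Y)) : exists f, shiftm f = h.
Proof. by have [g _ gK] := shiftm_bij X Y; exists (g h). Qed.

Lemma isomorphic_shift X Y : isomorphic (shift X) (shift Y) <-> isomorphic X Y.
Proof.
split=> [[f [g [gf fg]]]|[f [g [gf fg]]]].
  have [f0 f0E] := shiftm_surj f; have [g0 g0E] := shiftm_surj g.
  exists f0, g0; split; apply: shiftm_inj; rewrite shiftm_comp f0E g0E.
    by rewrite gf shiftm1.
  by rewrite fg shiftm1.
exists (shiftm f), (shiftm g).
by rewrite -!shiftm_comp gf fg !shiftm1.
Qed.

Lemma retract_unshift X Y : retract (shift X) (shift Y) -> retract X Y.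
Proof.
move=> [a [b ba]]; have [a0 a0E] := shiftm_surj a; have [b0 b0E] := shiftm_surj b.
by exists a0, b0; apply: shiftm_inj; rewrite shiftm_comp a0E b0E ba shiftm1.
Qed.

Lemma hom0_shift X Y : hom0 (shift X) (shift Y) <-> hom0 X Y.
Proof.
split=> h f; last by have [g <-] := shiftm_surj f; rewrite (h g) raddf0.
by apply: shiftm_inj; rewrite (h (shiftm f)) raddf0.
Qed.

(** A choice of objects X[-1], not made functorial. *)
Definition unshift : T -> T := projT1 (choice (@shift_esurj T)).

Lemma unshiftK X : isomorphic (shift (unshift X)) X.
Proof. exact: (projT2 (choice (@shift_esurj T))). Qed.

Lemma triangle_comp0 X Y Z (u : Hom X Y) (v : Hom Y Z) w :
  triangle u v w -> v \o u = 0.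
Proof.
move=> t; have [O O0] := zero_exists (@coproducts T).
have [|c [cv _]] := tr3 (a := idm X) (b := u) (tr1_id X O0) t; first by [].
by rewrite -cv compm0.
Qed.

Lemma is_zero_shift Z : is_zero Z -> is_zero (shift Z).
Proof. by move=> /is_zeroP Z0; apply/is_zeroP; rewrite -shiftm1 Z0 raddf0. Qed.

Lemma triangle_idr X Z : is_zero Z ->
  triangle (0 : Hom Z X) (idm X) (0 : Hom X (shift Z)).
Proof.
by move=> Z0; apply/tr2; rewrite raddf0 oppr0; apply/tr1_id/is_zero_shift.
Qed.

Lemma triangle_wcok X Y Z (u : Hom X Y) (v : Hom Y Z) w V (k : Hom Y V) :
  triangle u v w -> k \o u = 0 -> exists l, l \o v = k.
Proof.
move=> t ku; have [O O0] := zero_exists (@coproducts T).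
have [|c [cv _]] := tr3 (a := 0) (b := k) t (triangle_idr V O0).
  by rewrite ku compm0.
by exists c; rewrite cv comp1m.
Qed.

Lemma triangle_wker X Y Z (u : Hom X Y) (v : Hom Y Z) w V (k : Hom V Y) :
  triangle u v w -> v \o k = 0 -> exists l, u \o l = k.
Proof.
move=> /tr2 t vk; have [O O0] := zero_exists (@coproducts T).
have /tr2 t0 := tr1_id V O0.
have [|c [_]] := tr3 (a := k) (b := 0) t0 t; first by rewrite vk comp0m.
rewrite shiftm1 compmN compm1 compNm => /oppr_inj e.
have [l lc] := shiftm_surj c; exists l.
by apply: shiftm_inj; rewrite shiftm_comp lc e.
Qed.

Lemma triangle_unshift X Y Z (u : Hom X Y) (v : Hom Y Z) r :
  triangle (shiftm u) (shiftm v) r -> exists w, triangle u v w.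
Proof.
move=> t; have [w wr] := shiftm_surj (- r); exists w.
apply/tr2/tr2/tr2; rewrite wr opprK.
apply: (triangle_iso (a := idm _) (b := - idm _) (c := idm _)) t.
- exact: is_iso_id.
- exact/is_isoN/is_iso_id.
- exact: is_iso_id.
- by rewrite compNm comp1m compm1.
- by rewrite compNm compmN opprK comp1m compm1.
- by rewrite shiftm1 comp1m compm1.
Qed.

(** u and v are the first two morphisms of a triangle. *)
Definition wtriangle X Y Z (u : Hom X Y) (v : Hom Y Z) : Prop :=
  exists w, triangle u v w.

Lemma triangle_iso3 X Y Z Z' (u : Hom X Y) (v : Hom Y Z) w
    (c : Hom Z Z') (c' : Hom Z' Z) : c' \o c = idm Z -> c \o c' = idm Z' ->
  triangle u v w -> triangle u (c \o v) (w \o c').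
Proof.
move=> cc' c'c; apply: (triangle_iso (a := idm _) (b := idm _) (c := c)).
- exact: is_iso_id.
- exact: is_iso_id.
- by exists c'.
- by rewrite comp1m compm1.
- by rewrite compm1.
- by rewrite shiftm1 comp1m -compA cc' compm1.
Qed.

Lemma triangle_fib Y Z (g : Hom Y Z) : exists X (f : Hom X Y), wtriangle f g.
Proof.
have [Q [v [w t]]] := tr1_cone g; have [e [e' [e'e ee']]] := unshiftK Q.
have [f fE] := shiftm_surj (- (w \o e)).
exists (unshift Q), f, (e' \o v); apply/tr2; rewrite fE opprK.
exact: triangle_iso3 t.
Qed.

Lemma triangle_rotV X Y Z (f : Hom X Y) (g : Hom Y Z) :
  wtriangle f g -> exists h : Hom (unshift Z) X, wtriangle h f.
Proof.
move=> [h t]; have [e [e' [e'e ee']]] := unshiftK Z.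
have [k kE] := shiftm_surj (- (h \o e)).
exists k, (e' \o g); apply/tr2; rewrite kE opprK.
exact: triangle_iso3 t.
Qed.

Lemma triangle_split X Y S : is_coproduct2 X Y S ->
  exists (f : Hom X S) (g : Hom S Y), wtriangle f g.
Proof.
move=> /coproduct2P [i1 [i2 [p1 [p2 [e1 e2 e3 e4 e5]]]]].
have [Z [g [w t]]] := tr1_cone i1; exists i1, p2.
have t' := (tr2 _ _ _).1 t; have t'' := (tr2 _ _ _).1 t'.
have w0 : w = 0.
  have := triangle_comp0 t''; rewrite compNm => /eqP; rewrite oppr_eq0 => /eqP i1w.
  by rewrite -[w]comp1m -shiftm1 -e1 shiftm_comp -compA i1w compm0.
have [c cg] := triangle_wcok t e3.
have gg : g \o i2 \o c = idm Z.
  apply/eqP; rewrite -subr_eq0; apply/eqP.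
  have [|k <-] := @triangle_wcok _ _ _ _ _ _ _ ((g \o i2 \o c) - idm Z) t'.
    rewrite compBl comp1m -!compA cg.
    have -> : i2 \o p2 = idm S - (i1 \o p1) by rewrite -e5 addrAC subrr add0r.
    by rewrite compBr compm1 compA (triangle_comp0 t) comp0m subr0 subrr.
  by rewrite w0 compm0.
rewrite -cg; exists (w \o (g \o i2)); apply: triangle_iso3 t => //.
by rewrite compA cg e2.
Qed.

(** The induced maps c : Z -> Z' and c' : Z' -> Z need not satisfy c' c = 1,
    but c' c - 1 has square zero, so c' can be corrected. *)
Lemma triangle_retract X Y Z X' Y' Z' (f : Hom X Y) (g : Hom Y Z)
    (f' : Hom X' Y') (g' : Hom Y' Z')
    (a : Hom X X') (b : Hom Y Y') (a' : Hom X' X) (b' : Hom Y' Y) :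
  wtriangle f g -> wtriangle f' g' -> a' \o a = idm X -> b' \o b = idm Y ->
  f' \o a = b \o f -> f \o a' = b' \o f' -> retract Z Z'.
Proof.
move=> [h t] [h' t'] aa bb e e'.
have [c [cg hc]] := tr3 t t' (esym e).
have [c' [cg' hc']] := tr3 t' t (esym e').
pose n := (c' \o c) - idm Z.
have hn : h \o n = 0.
  rewrite compBr compm1 compA -hc' -compA -hc compA -shiftm_comp aa shiftm1.
  by rewrite comp1m subrr.
have [k kh] : exists k, k \o h = n.
  apply: (triangle_wcok ((tr2 _ _ _).1 t)).
  by rewrite compBl comp1m -compA cg compA cg' -compA bb compm1 subrr.
have nn : n \o n = 0 by rewrite -{1}kh -compA hn compm0.
exists c, ((idm Z - n) \o c'); rewrite -compA.
have -> : c' \o c = idm Z + n by rewrite addrC subrK.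
by rewrite compDr compm1 compBl comp1m nn subr0 subrK.
Qed.

(** The [wtri] structure underlying a triangulated category. *)
Definition weak_tri : wtri.
Proof.
exists (underlying T) (@shift T) unshift wtriangle.
- exact: coproducts.
- by move=> X Y; apply: iffRL (isomorphic_shift _ _).
- move=> X Y XY; apply/isomorphic_shift.
  apply: isomorphic_trans (unshiftK X) (isomorphic_trans XY _).
  exact/isomorphic_sym/unshiftK.
- by move=> X; apply/isomorphic_shift/unshiftK.
- exact: unshiftK.
- move=> X Y; split=> [/hom0_shift|] h.
    apply: hom0_retractl h.
    exact/isomorphic_retract/isomorphic_sym/unshiftK.
  apply/hom0_shift; apply: hom0_retractl h.
  exact/isomorphic_retract/unshiftK.
- by move=> X Y Z f g [h /triangle_comp0].
- by move=> X Y Z f g V k [h t]; apply: triangle_wker t.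
- by move=> X Y Z f g V k [h t]; apply: triangle_wcok t.
- exact: tr1_cone.
- exact: triangle_fib.
- by move=> X Y Z f g [h /tr2 t]; exists h, (- shiftm f).
- exact: triangle_rotV.
- by move=> X Z Z0; exists 0; apply: tr1_id.
- by move=> X Z Z0; exists 0; apply: triangle_idr.
- exact: triangle_split.
- move=> X Y Z A B C f g a b c [k1 t1] [k2 t2] [k3 t3].
  have [p [q [t _]]] := tr4 t1 t2 t3.
  by exists p, q; eexists; exact: t.
- move=> X Y Z A B C f g a b c [k1 /tr2 t1] [k2 /tr2 t2] [k3 /tr2 t3].
  have [P [Q [t _]]] := tr4 t1 t2 t3.
  have [p pP] := shiftm_surj P; have [q qQ] := shiftm_surj Q.
  by exists p, q; move: t; rewrite -pP -qQ => /triangle_unshift.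
- move=> X Y Z f g V [h t] fac YV k.
  have t' := (tr2 _ _ _).1 t; have t'' := (tr2 _ _ _).1 t'.
  have [l <-] := triangle_wcok t' (YV (k \o g)).
  have [q <-] := shiftm_surj l; have [q' <-] := fac q.
  have := triangle_comp0 t''; rewrite compNm => /eqP; rewrite oppr_eq0 => /eqP e.
  by rewrite shiftm_comp -compA e compm0.
- move=> X Y Z f g V [h t] fac.
  have adj A : hom0 (unshift V) A <-> hom0 V (shift A).
    rewrite -hom0_shift; split; apply: hom0_retractl; apply: isomorphic_retract.
      exact/isomorphic_sym/unshiftK.
    exact: unshiftK.
  rewrite !adj => VY k.
  have t' := (tr2 _ _ _).1 t; have t'' := (tr2 _ _ _).1 t'.
  have [l <-] := triangle_wker t'' (VY ((- shiftm f) \o k)).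
  by have [q <-] := fac l; rewrite compA (triangle_comp0 t') comp0m.
- exact: triangle_retract.
- move=> X Y Z X' Y' Z' f g f' g' b c b' c' [h /tr2 t] [h' /tr2 t'] bb cc e e'.
  apply: retract_unshift.
  apply: (triangle_retract (f := g) (f' := g') (a := b) (b := c)
    (a' := b') (b' := c')) => //.
    by exists (- shiftm f); exact: t.
  by exists (- shiftm f'); exact: t'.
Defined.

End TriangulatedIsWeak.

(** * Duality *)

Section OppositeSilting.
Variable W : wtri.
Implicit Types (M N P : set W).

Lemma wge_op M N : @wge (opw W) M N <-> wge N M.
Proof.
split=> h X Y i MX NY i0.
  apply/desusp_adj_iter; exact: (h Y X i NY MX i0).
have /desusp_adj_iter := h Y X i NY MX i0.
exact.
Qed.

Lemma wgt_op M N : @wgt (opw W) M N <-> wgt N M.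
Proof. by split=> -[/wge_op h ne]; split=> // e; apply: ne. Qed.

Lemma wthick_op P : @wthick (opw W) P <-> wthick P.
Proof.
have iso (X Y : W) : is_subcategory P -> isomorphic X Y -> P X <-> P Y.
  move=> [Piso _ _] XY; split; apply: Piso => //; exact: isomorphic_sym.
split=> -[sP Ps Pt].
  have {}sP : @is_subcategory W P by rewrite -is_subcategory_op.
  have Ps' (X : W) : P (susp X) <-> P X.
    by rewrite -(Ps (susp X)); apply: iso => //; apply: suspK.
  split=> // X Y Z t PX PY.
  have [f [g fg]] := tri_obj_rot (tri_obj_rot t).
  by apply: (Pt (susp Y) (susp X) Z); [exists g, f|apply/Ps'|apply/Ps'].
split; first by rewrite is_subcategory_op.
  move=> X; have e := iso _ _ sP (@desuspK W X).
  by split=> h; [apply/e/Ps|apply/Ps/e].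
move=> X Y Z [f [g fg]] PX PY.
have t : @tri_obj W Z Y X := ex_intro _ g (ex_intro _ f fg).
have [f' [g' t']] := tri_obj_rot t.
by apply/Ps; apply: Pt PY PX; exists f', g'.
Qed.

Lemma wsilting_op M : @wsilting (opw W) M <-> wsilting M.
Proof.
rewrite /wsilting is_subcategory_op.
have -> : @wthick (opw W) = @wthick W.
  by apply/funext => P; apply/propext/wthick_op.
by split=> -[sM /wge_op MM gen]; split.
Qed.

End OppositeSilting.

Section Transfer.
Variable T : triangulated.
Implicit Types (M N D L P : set T).
Let W := weak_tri T.

Lemma silting_weak M : silting M <-> @wsilting W M.
Proof.
rewrite /silting /wsilting.
suff -> : @is_thick T = @wthick W by [].
apply/funext => P; apply/propext; split=> -[sP Ps Pt]; split=> //.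
  by move=> X Y Z [f [g [h t]]]; apply: Pt t.
by move=> X Y Z f g h t; apply: Pt; exists f, g, h.
Qed.

Lemma left_mutation_weak M D N : is_left_mutation M D N <-> @wmutation W M D N.
Proof.
split=> -[cone [coneP ->]]; exists cone; split=> // X /coneP.
  by move=> [Y [f [g [h [fD t]]]]]; exists Y, f, g; split=> //; exists h.
by move=> [Y [f [g [fD [h t]]]]]; exists Y, f, g, h.
Qed.

Lemma right_mutation_weak M D N :
  is_right_mutation M D N <-> @wmutation (opw W) M D N.
Proof.
have addE : @add (opw W) = @add W by rewrite /add is_subcategory_op.
split=> -[cone [coneP ->]]; exists cone; split; rewrite ?addE // => X /coneP.
  by move=> [Y [f [g [h [gD t]]]]]; exists Y, g, f; split=> //; exists h.
by move=> [Y [g [f [gD [h t]]]]]; exists Y, f, g, h.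
Qed.

Lemma irreducible_left_weak M N :
  irreducible_left_mutation M N <-> @wirreducible_mutation W M N.
Proof.
by split=> -[X [D [MX iX rD /left_mutation_weak mN]]]; exists X, D; split.
Qed.

Lemma irreducible_right_weak M N :
  irreducible_right_mutation M N <-> @wirreducible_mutation (opw W) M N.
Proof.
split=> -[X [D [MX iX rD /right_mutation_weak mN]]]; exists X, D; split=> //.
- by move: iX; rewrite -(@indecomposable_op W).
- exact/is_remove_op.
- by move: iX; rewrite -(@indecomposable_op W).
- by apply/(@is_remove_op W).
Qed.

End Transfer.

Theorem theorem2p35 (T : triangulated) (hKS : krull_schmidt T)
    (hfin : forall (M : set T) (X : T) (D : set T),
      silting M -> M X -> indecomposable X -> is_remove M X D ->
      functorially_finite D M)
    (M N : set T) (hM : silting M) (hN : silting N) :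
  (irreducible_left_mutation M N <-> irreducible_right_mutation N M) /\
  (irreducible_right_mutation N M <->
     silting_gt M N /\
     ~ exists L : set T, [/\ silting L, silting_gt M L & silting_gt L N]).
Proof.
pose W := weak_tri T.
have left : irreducible_left_mutation M N <-> silting_gt M N /\
     ~ exists L : set T, [/\ silting L, silting_gt M L & silting_gt L N].
  apply: iff_trans (irreducible_left_weak M N) _.
  apply: (iff_trans (@irreducible_mutationP W hKS _ M N _ _)).
  - move=> P X D /silting_weak hP PX iX rD.
    by have [] := hfin _ _ _ hP PX iX rD.
  - exact/silting_weak.
  - exact/silting_weak.
  split=> -[MN none]; split=> // -[L [hL ML LN]]; apply: none; exists L;
    by split=> //; apply/silting_weak.
have right : irreducible_right_mutation N M <-> silting_gt M N /\
     ~ exists L : set T, [/\ silting L, silting_gt M L & silting_gt L N].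
  apply: iff_trans (irreducible_right_weak N M) _.
  apply: (iff_trans (@irreducible_mutationP (opw W) _ _ N M _ _)).
  - exact: krull_schmidt_op.
  - move=> P X D /wsilting_op /silting_weak hP PX iX /is_remove_op rD.
    rewrite indecomposable_op in iX.
    by have [_ fin] := hfin _ _ _ hP PX iX rD.
  - exact/wsilting_op/silting_weak.
  - exact/wsilting_op/silting_weak.
  split=> -[MN none]; split.
  - by case: MN => /wge_op MN ne; split=> // e; apply: ne.
  - move=> [L [hL ML LN]]; apply: none; exists L; split.
    + exact/wsilting_op/silting_weak.
    + exact/wgt_op.
    + exact/wgt_op.
  - by apply/(@wgt_op W).
  - move=> [L [/wsilting_op/silting_weak hL /wgt_op NL /wgt_op LM]].
    by apply: none; exists L.
by split; [apply: iff_trans left (iff_sym right)|].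
Qed.
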